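(* Let $U$ be a nonconstant solution, smooth on the closed interval $0\le\rho\le1$, of $$(1-\rho^2)\,U''(\rho)+\Big(\frac{2}{\rho}-4\rho\Big)U'(\rho)-2U(\rho)+U(\rho)^3=0 .$$ Then $U$ becomes singular at some finite $\rho_*>1$: the maximal smooth solution of the equation extending $U$ to $\rho>1$ exists only on $[0,\rho_* )$ with $1<\rho_*<\infty$. In particular, $U$ does not extend to a smooth solution on $[0,\infty)$.
   Context: The equation is the ODE satisfied by the profile of spherically symmetric self-similar solutions $u(t,r)=(T-t)^{-1}U(\rho)$, $\rho=r/(T-t)$, of the focusing cubic wave equation $\partial_{tt}u-\partial_{rr}u-\frac{2}{r}\partial_r u-u^3=0$; the region $\rho>1$ is the exterior of the past light cone of the point $(t,r)=(T,0)$. The points $\rho=0$ and $\rho=1$ are singular points of the ODE. For each $b\in\mathbb{R}$ there is a unique solution that is smooth in a (two-sided) neighbourhood of $\rho=1$ with $U(1)=b$; it satisfies $U(\rho)=b+\frac b2(b^2-2)(\rho-1)+\mathcal{O}((\rho-1)^2)$. A solution smooth on $[0,1]$ is continued past $\rho=1$ as this smooth solution. *)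

(* Defs.v *)
From Stdlib Require Import Reals.
Open Scope R_scope.

(** [D] is the sequence of successive derivatives of [U] on the set [J].
    [D_in] is the derivative relative to [J], so it is one-sided at an endpoint
    of an interval belonging to [J]; it is unique when [J] is a nondegenerate
    interval. Values of [U] outside [J] are irrelevant. *)
Definition successive_derivatives (J : R -> Prop) (U : R -> R)
    (D : nat -> R -> R) : Prop :=
  (forall rho, J rho -> D 0%nat rho = U rho) /\
  (forall n rho, J rho -> D_in (D n) (D (S n)) J rho).

(** The equation is imposed at every point of [J] except [0], where its
    coefficient [2 / rho] is undefined. At [rho = 1] it reads
    [- 2 U'(1) - 2 U(1) + U(1)^3 = 0]. *)
Definition smooth_solution (J : R -> Prop) (U : R -> R) : Prop :=
  exists D : nat -> R -> R,
    successive_derivatives J U D /\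
    forall rho, J rho -> rho <> 0 ->
      (1 - rho ^ 2) * D 2%nat rho + (2 / rho - 4 * rho) * D 1%nat rho
        - 2 * U rho + U rho ^ 3 = 0.

Definition extends_from_unit (U V : R -> R) : Prop :=
  forall rho, 0 <= rho <= 1 -> V rho = U rho.

(** An interval with left endpoint [0], possibly unbounded and with or without
    its right endpoint, that contains [[0, 1]]. *)
Definition extension_interval (J : R -> Prop) : Prop :=
  (forall rho, J rho -> 0 <= rho) /\
  (forall rho, 0 <= rho <= 1 -> J rho) /\
  (forall rho sigma, J sigma -> 0 <= rho <= sigma -> J rho).

(** Maximality is tested against intervals [J] of either kind, so that it also
    excludes a smooth solution on the closed interval [[0, rho_star]]. Smoothness
    on [J] at interior points is two-sided, in particular at [rho = 1] as soon
    as [J] reaches beyond it. *)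
Definition maximal_smooth_extension (U : R -> R) (rho_star : R) (V : R -> R)
    : Prop :=
  extends_from_unit U V /\
  smooth_solution (fun rho => 0 <= rho < rho_star) V /\
  (forall (J : R -> Prop) (W : R -> R),
     extension_interval J -> extends_from_unit U W -> smooth_solution J W ->
     forall rho, J rho -> rho < rho_star /\ W rho = V rho).

(* Main.v *)
Require Import Defs.
From Stdlib Require Import Reals Lra Lia Classical ClassicalEpsilon.
From Coquelicot Require Import Coquelicot.
Open Scope R_scope.

(** The proof reads off the fate of the solution from the single number
    [b = U 1].

    Inside the light cone, regularity on [[0, 1]] forces [b ^ 2 > 2] unless [U]
    is constant ([large_value_at_one]). In the variable [w = rho U] with
    [rho = tanh x] the equation is the Emden-Fowler equation
    [w'' + w ^ 3 / sinh ^ 2 x = 0], whose Pohozaev functional with multiplier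
    [sinh ^ (2/3)] has a derivative free of the quartic term. Subtracting
    [(w / w0) ^ 2] times the functional of the reference solution
    [w0 = sqrt 2 tanh x], and raising the difference to the third power to stay
    rational, gives [N = rho ^ 5 (1 - rho ^ 2) ^ 2 G ^ 3] with
    [N' = - (2/3) rho ^ 4 (1 - rho ^ 2) G ^ 2 U U'] ([pohozaev_derivative]). If
    [0 < b ^ 2 < 2] then [U U' < 0] at [1]. Going left to the last zero [r] of
    [U U'] (or to [r = 0]), [N] is nondecreasing on [[r, 1]], vanishes at [1]
    and is nonnegative at [r], hence vanishes on [[r, 1]], which contradicts
    [U U' < 0]. If [b] is one of the equilibria [0], [sqrt 2], [- sqrt 2], then
    [U] is constant because a solution is determined by its value at the
    singular point [1].

    Outside the light cone, say [b > sqrt 2]. The inequality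
    [rho U' > (U ^ 2 - 2) / 4] holds at [1] and propagates to the right
    ([riccati_barrier]); it makes [1 / (U - sqrt 2) + ln rho / 4] nonincreasing,
    so no smooth extension reaches [exp (4 / (b - sqrt 2))]
    ([finite_lifespan]).

    The maximal extension itself needs a continuation of every smooth solution
    on [[0, r]] with [r >= 1] to the right of [r] ([extension_beyond]). It is
    given by a convergent power series at [r] ([analytic_solution]). The series
    also defines a solution on the left of [r], where it coincides with the
    given one by uniqueness of the Cauchy problem at [r]; hence all derivatives
    match and the two pieces glue smoothly, also at the singular point
    [r = 1]. Uniqueness to the right of [1] makes all extensions agree
    ([extensions_agree]), and their union is the maximal one. *)

(** * Elementary calculus *)

(** Evaluates the derivatives of abstract functions left by [auto_derive]. *)
Ltac rewrite_derive H :=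
  match type of H with is_derive ?f ?x ?l =>
    replace (Derive (fun y : R => f y) x) with l
      by (symmetry; exact (is_derive_unique f x l H)) end.

Lemma is_derive_continuity_pt (f : R -> R) (x l : R) :
  is_derive f x l -> continuity_pt f x.
Proof.
  intros H. apply derivable_continuous_pt. exists l.
  now apply is_derive_Reals.
Qed.

Lemma nondecreasing_of_derivative (f f' : R -> R) (a b : R) :
  a <= b -> (forall x, a <= x <= b -> is_derive f x (f' x)) ->
  (forall x, a < x < b -> 0 <= f' x) -> f a <= f b.
Proof.
  intros [Hab | <-] Hd Hp; [| lra].
  destruct (MVT_cor2 f f' a b Hab) as [c [Hc Hc']].
  - intros c Hc. apply is_derive_Reals, Hd, Hc.
  - assert (0 <= f' c) by now apply Hp. nra.
Qed.

Lemma bounded_on_segment (f : R -> R) (a b : R) :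
  a <= b -> (forall x, a <= x <= b -> continuity_pt f x) ->
  exists M, 0 <= M /\ forall x, a <= x <= b -> Rabs (f x) <= M.
Proof.
  intros Hab Hc.
  destruct (continuity_ab_maj (fun x => Rabs (f x)) a b Hab) as [m [Hm _]].
  - intros c H. apply (continuity_pt_comp f Rabs); [now apply Hc|].
    apply Rcontinuity_abs.
  - exists (Rabs (f m)). split; [apply Rabs_pos | exact Hm].
Qed.

(** The set of points of nonnegativity, completed by [a], has a supremum; by
    continuity [h] can be neither negative nor positive there unless it is
    [a]. *)
Lemma last_zero (h : R -> R) (a b : R) :
  a <= b -> (forall x, a <= x <= b -> continuity_pt h x) -> h b < 0 ->
  exists r, a <= r <= b /\ (forall x, r < x <= b -> h x < 0) /\
    (r = a \/ h r = 0).
Proof.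
  intros Hab Hc Hb.
  set (S := fun x => x = a \/ (a <= x <= b /\ 0 <= h x)).
  destruct (completeness S) as [r [Hub Hlub]].
  - exists b. intros x [-> | [Hx _]]; lra.
  - exists a. now left.
  - assert (Har : a <= r) by (apply Hub; now left).
    assert (Hrb : r <= b).
    { apply Hlub. intros x [-> | [Hx _]]; lra. }
    assert (Hneg : forall x, r < x <= b -> h x < 0).
    { intros x Hx. apply Rnot_le_lt. intros H.
      assert (x <= r) by (apply Hub; right; split; lra). lra. }
    exists r. split; [lra|]. split; [exact Hneg|].
    destruct (Req_dec r a) as [| Hra]; [now left | right].
    assert (Hcr := Hc r (conj Har Hrb)).
    destruct (Rtotal_order (h r) 0) as [Hlt | [| Hgt]]; [| assumption |].
    + (* a negative value at r persists on the left, against leastness of r *)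
      exfalso.
      destruct (Hcr (- h r)) as [d [Hd Hcd]]; [lra|].
      assert (r <= Rmax a (r - d / 2)).
      { apply Hlub. intros x [-> | [Hx H0]]; [apply Rmax_l|].
        apply Rle_trans with (2 := Rmax_r _ _).
        apply Rnot_lt_le. intros Hxd.
        assert (x <= r) by (apply Hub; right; split; lra).
        destruct (Req_dec x r) as [-> | Hxr]; [lra|].
        assert (Habs : R_dist (h x) (h r) < - h r).
        { apply Hcd. split; [split; [exact I | lra]|].
          simpl. unfold R_dist. apply Rabs_def1; lra. }
        unfold R_dist in Habs. apply Rabs_def2 in Habs. lra. }
      assert (Rmax a (r - d / 2) < r) by (apply Rmax_lub_lt; lra). lra.
    + (* a positive value at r persists on the right, where h is negative *)
      exfalso.
      assert (Hrb' : r <> b) by (intros ->; lra).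
      destruct (Hcr (h r)) as [d [Hd Hcd]]; [lra|].
      set (x := Rmin b (r + d / 2)).
      assert (Hx : r < x) by (apply Rmin_glb_lt; lra).
      assert (x <= b) by apply Rmin_l.
      assert (x <= r + d / 2) by apply Rmin_r.
      assert (Habs : R_dist (h x) (h r) < h r).
      { apply Hcd. split; [split; [exact I | lra]|].
        simpl. unfold R_dist. apply Rabs_def1; lra. }
      unfold R_dist in Habs. apply Rabs_def2 in Habs.
      assert (h x < 0) by (apply Hneg; lra). lra.
Qed.

(** [E exp (- K x)] is nonincreasing. *)
Lemma gronwall_right (E E' : R -> R) (K a b : R) :
  (forall x, a <= x <= b -> is_derive E x (E' x)) ->
  (forall x, a < x < b -> E' x <= K * E x) ->
  (forall x, a <= x <= b -> 0 <= E x) -> E a = 0 ->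
  forall x, a <= x <= b -> E x = 0.
Proof.
  intros Hd Hle Hpos H0 x Hx.
  assert (H : - (E a * exp (- K * a)) <= - (E x * exp (- K * x))).
  { apply (nondecreasing_of_derivative
      (fun y => - (E y * exp (- K * y)))
      (fun y => (K * E y - E' y) * exp (- K * y))); [lra | |].
    - intros y Hy. assert (HE := Hd y ltac:(lra)).
      auto_derive; [repeat split; now exists (E' y)|].
      rewrite_derive HE. ring.
    - intros y Hy. apply Rmult_le_pos; [| left; apply exp_pos].
      assert (E' y <= K * E y) by (apply Hle; lra). lra. }
  rewrite H0 in H. assert (0 < exp (- K * x)) by apply exp_pos.
  assert (0 <= E x) by now apply Hpos. nra.
Qed.

(** [E exp (K x)] is nondecreasing. *)
Lemma gronwall_left (E E' : R -> R) (K a b : R) :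
  (forall x, a <= x <= b -> is_derive E x (E' x)) ->
  (forall x, a < x < b -> - K * E x <= E' x) ->
  (forall x, a <= x <= b -> 0 <= E x) -> E b = 0 ->
  forall x, a <= x <= b -> E x = 0.
Proof.
  intros Hd Hle Hpos H0 x Hx.
  assert (H : E x * exp (K * x) <= E b * exp (K * b)).
  { apply (nondecreasing_of_derivative
      (fun y => E y * exp (K * y))
      (fun y => (K * E y + E' y) * exp (K * y))); [lra | |].
    - intros y Hy. assert (HE := Hd y ltac:(lra)).
      auto_derive; [repeat split; now exists (E' y)|].
      rewrite_derive HE. ring.
    - intros y Hy. apply Rmult_le_pos; [| left; apply exp_pos].
      assert (- K * E y <= E' y) by (apply Hle; lra). lra. }
  rewrite H0 in H. assert (0 < exp (K * x)) by apply exp_pos.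
  assert (0 <= E x) by now apply Hpos. nra.
Qed.

Lemma larger_value_on_the_right (f : R -> R) (x l d : R) :
  is_derive f x l -> 0 < l -> 0 < d -> exists y, x < y < x + d /\ f x < f y.
Proof.
  intros Hf Hl Hd. apply is_derive_Reals in Hf.
  destruct (Hf l Hl) as [e He]. assert (0 < e) by apply cond_pos.
  set (h := Rmin (e / 2) (d / 2)).
  assert (0 < h) by (apply Rmin_glb_lt; lra).
  assert (h <= e / 2) by apply Rmin_l. assert (h <= d / 2) by apply Rmin_r.
  exists (x + h). split; [lra|].
  assert (H' : Rabs ((f (x + h) - f x) / h - l) < l).
  { apply He; [lra|]. rewrite Rabs_right; lra. }
  apply Rabs_def2 in H'.
  assert (0 < (f (x + h) - f x) / h * h) by (apply Rmult_lt_0_compat; lra).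
  replace ((f (x + h) - f x) / h * h) with (f (x + h) - f x) in * by (field; lra).
  lra.
Qed.

(** [f x + g x - Rabs (f x - g x)] is twice the minimum of the two functions,
    so its first zero, obtained from [last_zero] by reflection, is the first
    point where one of them vanishes. *)
Lemma first_joint_zero (f g : R -> R) (a b : R) :
  a <= b -> (forall x, a <= x <= b -> continuity_pt f x) ->
  (forall x, a <= x <= b -> continuity_pt g x) -> 0 < f a -> 0 < g a ->
  exists r, a <= r <= b /\ (forall x, a <= x < r -> 0 < f x /\ 0 < g x) /\
    (r = b \/ f r = 0 \/ g r = 0).
Proof.
  intros Hab Hf Hg Hfa Hga.
  set (h := fun x => f x + g x - Rabs (f x - g x)).
  assert (Hh : forall x, a <= x <= b -> continuity_pt h x).
  { intros x Hx. apply continuity_pt_minus.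
    - apply continuity_pt_plus; [now apply Hf | now apply Hg].
    - apply (continuity_pt_comp (fun x => f x - g x) Rabs);
        [| apply Rcontinuity_abs].
      apply continuity_pt_minus; [now apply Hf | now apply Hg]. }
  assert (Hpos : forall x, 0 < h x <-> 0 < f x /\ 0 < g x).
  { intros x. unfold h, Rabs. destruct (Rcase_abs _); lra. }
  destruct (last_zero (fun y => - h (- y)) (- b) (- a)) as [r [Hr [Hneg Hz]]].
  { lra. }
  { intros x Hx. apply continuity_pt_opp.
    apply (continuity_pt_comp Ropp h); [| apply Hh; lra].
    apply continuity_pt_opp, derivable_continuous_pt, derivable_pt_id. }
  { rewrite Ropp_involutive. apply Ropp_lt_gt_0_contravar, Hpos. lra. }
  exists (- r). split; [lra|]. split.
  - intros x Hx. apply Hpos. specialize (Hneg (- x) ltac:(lra)).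
    cbv beta in Hneg. rewrite Ropp_involutive in Hneg. lra.
  - cbv beta in Hz. destruct Hz as [Hz | Hz]; [left; lra | right].
    unfold h, Rabs in Hz. destruct (Rcase_abs _) in Hz; lra.
Qed.

(** * Twice differentiable solutions on a segment *)

(** The derivatives are two-sided also at the endpoints; the equation is
    imposed only at the positive points of the segment. Any smooth solution can
    be put in this form, see [solution_family_solves]. *)
Definition solves_on (a b : R) (u u1 u2 : R -> R) : Prop :=
  forall x, a <= x <= b ->
    is_derive u x (u1 x) /\ is_derive u1 x (u2 x) /\
    (0 < x -> (1 - x ^ 2) * u2 x + (2 / x - 4 * x) * u1 x
       - 2 * u x + u x ^ 3 = 0).

Lemma solves_on_sub (a b c d : R) (u u1 u2 : R -> R) :
  a <= c -> d <= b -> solves_on a b u u1 u2 -> solves_on c d u u1 u2.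
Proof. intros Hac Hdb H x Hx. apply H. lra. Qed.

Lemma solves_on_opp (a b : R) (u u1 u2 : R -> R) :
  solves_on a b u u1 u2 ->
  solves_on a b (fun x => - u x) (fun x => - u1 x) (fun x => - u2 x).
Proof.
  intros H x Hx. destruct (H x Hx) as [H1 [H2 H3]].
  split; [now apply (is_derive_opp (V := R_NormedModule))|].
  split; [now apply (is_derive_opp (V := R_NormedModule))|].
  intros Hp. rewrite <- Ropp_0, <- (H3 Hp). ring.
Qed.

Lemma solves_on_const (a b k : R) :
  k ^ 3 = 2 * k -> solves_on a b (fun _ => k) (fun _ => 0) (fun _ => 0).
Proof.
  intros Hk x Hx. split; [apply (is_derive_const (V := R_NormedModule))|].
  split; [apply (is_derive_const (V := R_NormedModule))|]. intros _. rewrite Hk. ring.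
Qed.

(** * Uniqueness of the Cauchy problem *)

Lemma energy_derivative (s : R) (w w1 : R -> R) (x l1 l2 : R) :
  is_derive w x l1 -> is_derive w1 x l2 ->
  is_derive (fun y => s * (y ^ 2 - 1) * w1 y ^ 2 + w y ^ 2) x
    (s * (2 * x * w1 x ^ 2 + 2 * (x ^ 2 - 1) * w1 x * l2) + 2 * w x * l1).
Proof.
  intros H1 H2. auto_derive; [repeat split; [now exists l2 | now exists l1]|].
  rewrite_derive H1. rewrite_derive H2. ring.
Qed.

Lemma energy_nonneg (p q w : R) : 0 <= p -> 0 <= p * q ^ 2 + w ^ 2.
Proof.
  intros Hp. assert (0 <= q ^ 2) by apply pow2_ge_0.
  assert (0 <= w ^ 2) by apply pow2_ge_0.
  assert (0 <= p * q ^ 2) by now apply Rmult_le_pos. lra.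
Qed.

Lemma energy_zero (p q w : R) : 0 <= p -> p * q ^ 2 + w ^ 2 = 0 -> w = 0.
Proof.
  intros Hp H. assert (0 <= q ^ 2) by apply pow2_ge_0.
  assert (0 <= p * q ^ 2) by now apply Rmult_le_pos.
  apply Rsqr_0_uniq. unfold Rsqr. nra.
Qed.

Section Uniqueness.
Variables (a b : R) (u u1 u2 v v1 v2 : R -> R).
Hypothesis (Ha : 0 < a) (Hab : a <= b).
Hypothesis (Hu : solves_on a b u u1 u2) (Hv : solves_on a b v v1 v2).

Let w x := u x - v x.
Let w1 x := u1 x - v1 x.
Let c x := 2 - (u x ^ 2 + u x * v x + v x ^ 2).

(** The equation is used to eliminate [(x ^ 2 - 1) w''], so the formula does
    not degenerate at the singular point. The sign [s] makes the energy
    nonnegative: [s = 1] to the right of [1] and [s = -1] to the left. *)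
Lemma energy_of_difference (s x : R) : a <= x <= b ->
  is_derive (fun y => s * (y ^ 2 - 1) * w1 y ^ 2 + w y ^ 2) x
    (s * ((4 / x - 6 * x) * w1 x ^ 2 - 2 * c x * w x * w1 x)
      + 2 * w x * w1 x).
Proof.
  intros Hx. destruct (Hu x Hx) as [U1 [U2 U3]].
  destruct (Hv x Hx) as [V1 [V2 V3]].
  assert (W1 : is_derive w x (w1 x)) by exact (is_derive_minus u v x _ _ U1 V1).
  assert (W2 : is_derive w1 x (u2 x - v2 x)) by exact (is_derive_minus u1 v1 x _ _ U2 V2).
  assert (Hx0 : 0 < x) by lra.
  evar_last; [exact (energy_derivative s w w1 x _ _ W1 W2)|].
  assert (H : (x ^ 2 - 1) * (u2 x - v2 x)
              = (2 / x - 4 * x) * w1 x - c x * w x).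
  { specialize (U3 Hx0). specialize (V3 Hx0). unfold c, w, w1. nra. }
  replace (2 * (x ^ 2 - 1) * w1 x * (u2 x - v2 x))
    with (2 * w1 x * ((x ^ 2 - 1) * (u2 x - v2 x))) by ring.
  rewrite H. field. lra.
Qed.

Lemma coupling_bounded :
  exists M, 0 <= M /\ forall x, a <= x <= b -> Rabs (c x) <= M.
Proof.
  apply bounded_on_segment; [exact Hab|]. intros x Hx.
  destruct (Hu x Hx) as [U1 _]. destruct (Hv x Hx) as [V1 _].
  apply (is_derive_continuity_pt c x
    (- (2 * u x * u1 x + (u1 x * v x + u x * v1 x) + 2 * v x * v1 x))).
  unfold c. auto_derive; [repeat split; eexists; eassumption|].
  rewrite_derive U1. rewrite_derive V1. ring.
Qed.

Lemma cross_term_bound (M y : R) : 0 <= M ->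
  forall p q, Rabs y <= M ->
    Rabs (2 * (y * p * q)) <= q ^ 2 + M ^ 2 * p ^ 2.
Proof.
  intros HM p q Hy.
  rewrite !Rabs_mult, (Rabs_right 2) by lra.
  rewrite <- (pow2_abs p), <- (pow2_abs q).
  assert (0 <= Rabs p) by apply Rabs_pos.
  assert (0 <= Rabs q) by apply Rabs_pos.
  assert (0 <= Rabs y) by apply Rabs_pos.
  assert (Rabs y * Rabs p <= M * Rabs p) by (apply Rmult_le_compat_r; lra).
  assert (0 <= (Rabs q - M * Rabs p) ^ 2) by apply pow2_ge_0.
  nra.
Qed.

Lemma cross_bound : exists M, 0 <= M /\ forall x s, a <= x <= b ->
  Rabs s = 1 ->
  Rabs (s * (- 2 * c x * w x * w1 x) + 2 * w x * w1 x)
    <= w1 x ^ 2 + M * w x ^ 2.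
Proof.
  destruct coupling_bounded as [M [HM Hc]].
  exists ((1 + M) ^ 2). split; [apply pow2_ge_0|]. intros x s Hx Hs.
  replace (s * (- 2 * c x * w x * w1 x) + 2 * w x * w1 x)
    with (2 * ((1 - s * c x) * w x * w1 x)) by ring.
  apply cross_term_bound; [lra|].
  apply Rle_trans with (1 := Rabs_triang _ _).
  rewrite Rabs_Ropp, Rabs_mult, Hs, Rabs_R1. specialize (Hc x Hx). lra.
Qed.

(** At the singular point the energy [(x ^ 2 - 1) w' ^ 2 + w ^ 2] does not see
    the slope, so the value alone determines the solution. To the right of [1]
    the coefficient [4 / x - 6 x] of [w' ^ 2] is at most [- 2], which absorbs
    the cross terms. *)
Lemma unique_right_of_one : a = 1 -> u 1 = v 1 ->
  forall x, a <= x <= b -> u x = v x.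
Proof.
  intros Ea H1. destruct cross_bound as [M [HM Hb]].
  assert (H : forall x, a <= x <= b ->
    1 * (x ^ 2 - 1) * w1 x ^ 2 + w x ^ 2 = 0).
  { eapply (gronwall_right _ _ M).
    - intros x Hx. now apply energy_of_difference.
    - intros x Hx. cbv beta.
      assert (Hb' := Hb x 1 ltac:(lra) Rabs_R1). apply Rabs_le_between in Hb'.
      assert (/ x <= 1) by (rewrite <- Rinv_1; apply Rinv_le_contravar; lra).
      assert (0 <= w1 x ^ 2) by apply pow2_ge_0.
      assert ((4 / x - 6 * x) * w1 x ^ 2 <= - 2 * w1 x ^ 2).
      { apply Rmult_le_compat_r; [assumption|]. unfold Rdiv. lra. }
      assert (0 <= M * ((x ^ 2 - 1) * w1 x ^ 2)).
      { apply Rmult_le_pos; [lra|]. apply Rmult_le_pos; [nra | assumption]. }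
      nra.
    - intros x Hx. apply energy_nonneg. nra.
    - cbv beta. unfold w. rewrite Ea, H1. ring. }
  intros x Hx. apply Rminus_diag_uniq.
  refine (energy_zero _ (w1 x) _ _ (H x Hx)). nra.
Qed.

(** For the energy [(1 - x ^ 2) w' ^ 2 + w ^ 2] the coefficient [6 x - 4 / x] of
    [w' ^ 2] has the favourable sign only near [1]; further left the loss is
    controlled by the energy itself, since it is bounded by a multiple of
    [1 - x ^ 2]. *)
Lemma unique_left_of_one : b = 1 -> u 1 = v 1 ->
  forall x, a <= x <= b -> u x = v x.
Proof.
  intros Eb H1. destruct cross_bound as [M [HM Hb]].
  assert (Hia : 0 < / a) by now apply Rinv_0_lt_compat.
  assert (H : forall x, a <= x <= b ->
    -1 * (x ^ 2 - 1) * w1 x ^ 2 + w x ^ 2 = 0).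
  { eapply (gronwall_left _ _ (M + 6 + 4 / a)).
    - intros x Hx. now apply energy_of_difference.
    - intros x Hx. cbv beta.
      assert (Hb' := Hb x (-1) ltac:(lra)
        ltac:(rewrite Rabs_left; lra)). apply Rabs_le_between in Hb'.
      assert (Hxa : / x <= / a) by (apply Rinv_le_contravar; lra).
      assert (0 <= w1 x ^ 2) by apply pow2_ge_0.
      assert (0 <= w x ^ 2) by apply pow2_ge_0.
      assert (w1 x ^ 2 - (6 + 4 / a) * ((1 - x ^ 2) * w1 x ^ 2)
              <= (6 * x - 4 / x) * w1 x ^ 2).
      { apply Rle_trans with ((1 - (6 + 4 / a) * (1 - x ^ 2)) * w1 x ^ 2); [right; ring|].
        apply Rmult_le_compat_r; [assumption|].
        replace (6 * x - 4 / x) with (2 - (1 - x) * (6 + 4 / x)) by (field; lra).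
        unfold Rdiv. assert (0 <= (1 - x) * (/ a - / x)) by (apply Rmult_le_pos; lra).
        assert (0 <= x * (1 - x) * / a) by (apply Rmult_le_pos; nra). nra. }
      assert (0 <= (1 - x ^ 2) * w1 x ^ 2) by (apply Rmult_le_pos; [nra | assumption]).
      assert (0 <= M * ((1 - x ^ 2) * w1 x ^ 2)) by (apply Rmult_le_pos; lra).
      assert (0 <= (6 + 4 / a) * w x ^ 2).
      { apply Rmult_le_pos; [unfold Rdiv|]; lra. }
      nra.
    - intros x Hx. apply energy_nonneg. nra.
    - cbv beta. unfold w. rewrite Eb, H1. ring. }
  intros x Hx. apply Rminus_diag_uniq.
  refine (energy_zero _ (w1 x) _ _ (H x Hx)). nra.
Qed.

(** Away from [1] the energy [(x ^ 2 - 1) w' ^ 2 + w ^ 2] controls [w' ^ 2]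
    uniformly. *)
Lemma unique_left_of_regular : 1 < a -> u b = v b -> u1 b = v1 b ->
  forall x, a <= x <= b -> u x = v x.
Proof.
  intros Ha1 H0 H1. destruct cross_bound as [M [HM Hb]].
  set (k := (6 * b + 1) / (a ^ 2 - 1)).
  assert (Hk : 0 <= k).
  { apply Rmult_le_pos; [lra|]. left. apply Rinv_0_lt_compat. nra. }
  assert (H : forall x, a <= x <= b ->
    1 * (x ^ 2 - 1) * w1 x ^ 2 + w x ^ 2 = 0).
  { eapply (gronwall_left _ _ (M + k)).
    - intros x Hx. now apply energy_of_difference.
    - intros x Hx. cbv beta.
      assert (Hb' := Hb x 1 ltac:(lra) Rabs_R1). apply Rabs_le_between in Hb'.
      assert (0 < / x) by (apply Rinv_0_lt_compat; lra).
      assert (0 <= w1 x ^ 2) by apply pow2_ge_0.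
      assert (0 <= w x ^ 2) by apply pow2_ge_0.
      assert (Hkx : 6 * b + 1 <= k * (x ^ 2 - 1)).
      { replace (6 * b + 1) with (k * (a ^ 2 - 1)) by (unfold k; field; nra).
        apply Rmult_le_compat_l; nra. }
      assert ((6 * b + 1) * w1 x ^ 2 <= k * (x ^ 2 - 1) * w1 x ^ 2)
        by now apply Rmult_le_compat_r.
      assert (- (6 * b) * w1 x ^ 2 <= (4 / x - 6 * x) * w1 x ^ 2).
      { apply Rmult_le_compat_r; [assumption|]. unfold Rdiv. lra. }
      assert (0 <= M * ((x ^ 2 - 1) * w1 x ^ 2)).
      { apply Rmult_le_pos; [lra|]. apply Rmult_le_pos; [nra | assumption]. }
      assert (0 <= k * w x ^ 2) by now apply Rmult_le_pos.
      nra.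
    - intros x Hx. apply energy_nonneg. nra.
    - cbv beta. unfold w, w1. rewrite H0, H1. ring. }
  intros x Hx. apply Rminus_diag_uniq.
  refine (energy_zero _ (w1 x) _ _ (H x Hx)). nra.
Qed.

End Uniqueness.

(** * Inside the light cone *)

Section Interior.
Variables u u1 u2 : R -> R.
Hypothesis Hu : solves_on 0 1 u u1 u2.

(** Up to the factor [x (1 - x ^ 2) sinh ^ (2/3)], the difference between the
    Pohozaev functional of [w = x u] and [(u / sqrt 2) ^ 2] times that of
    [w0 = sqrt 2 x]. *)
Let G x := x * (1 - x ^ 2) * u1 x ^ 2 / 2 + (2 / 3 - x ^ 2) * u x * u1 x
  + x * (u x ^ 4 - 2 * u x ^ 2) / 4.

(** The right-hand side has a constant coefficient: the functional of the
    reference solution is exactly [2 / 9] of its multiplier. *)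
Lemma pohozaev_density_derivative (x : R) : 0 <= x <= 1 ->
  exists l, is_derive G x l /\
    (0 < x < 1 -> 3 * x * (1 - x ^ 2) * l + (5 - 9 * x ^ 2) * G x
      = - (2 / 3) * (u x * u1 x)).
Proof.
  intros Hx. destruct (Hu x ltac:(lra)) as [U1 [U2 U3]].
  exists ((1 - 3 * x ^ 2) * u1 x ^ 2 / 2 + x * (1 - x ^ 2) * u1 x * u2 x
    - 2 * x * u x * u1 x + (2 / 3 - x ^ 2) * (u1 x ^ 2 + u x * u2 x)
    + (u x ^ 4 - 2 * u x ^ 2) / 4 + x * (u x ^ 3 - u x) * u1 x).
  split.
  - unfold G. auto_derive; [repeat split; eexists; eassumption|].
    rewrite_derive U1. rewrite_derive U2. field.
  - intros Hx'. specialize (U3 ltac:(lra)).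
    assert (Hn : 1 - x ^ 2 <> 0) by (apply Rgt_not_eq; nra).
    set (A := 2 * u x - u x ^ 3 - (2 / x - 4 * x) * u1 x).
    assert (H : u2 x = A / (1 - x ^ 2)).
    { apply Rmult_eq_reg_l with (1 - x ^ 2); [| exact Hn].
      replace ((1 - x ^ 2) * (A / (1 - x ^ 2))) with A by (field; exact Hn).
      unfold A. lra. }
    rewrite H. unfold A, G. field. split; [lra | exact Hn].
Qed.

Let N x := x ^ 5 * (1 - x ^ 2) ^ 2 * G x ^ 3.

(** [N] is the third power of the functional difference, which clears the
    fractional power of [sinh]; the weight is the integrating factor that
    removes the term [(5 - 9 x ^ 2) G] of the previous identity. *)
Lemma pohozaev_derivative (x : R) : 0 <= x <= 1 ->
  is_derive N x (- (2 / 3) * x ^ 4 * (1 - x ^ 2) * G x ^ 2 * (u x * u1 x)).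
Proof.
  intros Hx. destruct (pohozaev_density_derivative x Hx) as [l [Hl Hid]].
  unfold N. auto_derive; [repeat split; eexists; eassumption|].
  rewrite_derive Hl.
  transitivity (x ^ 4 * (1 - x ^ 2) * G x ^ 2
    * (3 * x * (1 - x ^ 2) * l + (5 - 9 * x ^ 2) * G x)); [ring|].
  destruct (Req_dec x 0) as [-> | H0]; [ring|].
  destruct (Req_dec x 1) as [-> | H1]; [ring|].
  rewrite (Hid ltac:(lra)). ring.
Qed.

Lemma slope_at_one : u1 1 = u 1 * (u 1 ^ 2 - 2) / 2.
Proof. destruct (Hu 1 ltac:(lra)) as [_ [_ H]]. specialize (H Rlt_0_1). lra. Qed.

Lemma product_derivative (x : R) : 0 <= x <= 1 ->
  is_derive (fun y => u y * u1 y) x (u1 x ^ 2 + u x * u2 x).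
Proof.
  intros Hx. destruct (Hu x Hx) as [U1 [U2 _]].
  auto_derive; [repeat split; eexists; eassumption|].
  rewrite_derive U1. rewrite_derive U2. ring.
Qed.

(** The sign of [N] at the last critical point [r > 0] of [u ^ 2] is that of
    [u r ^ 2 - 2]. It is not negative: [u] has a critical point at [r] and
    [u ^ 2] decreases afterwards, whereas for [0 < u r ^ 2 < 2] the equation
    makes [u ^ 2] strictly convex at [r]. *)
Lemma no_small_value_at_one : u 1 <> 0 -> 2 <= u 1 ^ 2.
Proof.
  intros Hb. apply Rnot_lt_le. intros Hb2.
  assert (Hb0 : 0 < u 1 ^ 2) by now apply pow2_gt_0.
  destruct (last_zero (fun x => u x * u1 x) 0 1) as [r [Hr [Hneg Hz]]].
  { lra. }
  { intros x Hx. now apply (is_derive_continuity_pt _ _ _ (product_derivative x Hx)). }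
  { rewrite slope_at_one. nra. }
  cbv beta in Hz.
  assert (Hr1 : r < 1).
  { destruct (Req_dec r 1) as [-> | H]; [| lra].
    destruct Hz as [H | H]; [lra|]. rewrite slope_at_one in H. nra. }
  assert (Hbig : u 1 ^ 2 <= u r ^ 2).
  { apply Ropp_le_cancel.
    apply (nondecreasing_of_derivative (fun x => - u x ^ 2)
      (fun x => - (2 * (u x * u1 x)))); [lra | |].
    - intros x Hx. destruct (Hu x ltac:(lra)) as [U1 _].
      auto_derive; [repeat split; eexists; eassumption|].
      rewrite_derive U1. ring.
    - intros x Hx. assert (u x * u1 x < 0) by (apply Hneg; lra). lra. }
  assert (HN : forall x y, r <= x -> x <= y <= 1 -> N x <= N y).
  { intros x y Hx Hy. eapply nondecreasing_of_derivative; [lra | |].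
    - intros z Hz'. apply pohozaev_derivative. lra.
    - intros z Hz'. cbv beta. assert (u z * u1 z < 0) by (apply Hneg; lra).
      assert (0 <= z ^ 4) by (apply pow_le; lra).
      assert (0 <= G z ^ 2) by apply pow2_ge_0.
      assert (0 <= z ^ 4 * (1 - z ^ 2)) by (apply Rmult_le_pos; nra).
      assert (0 <= z ^ 4 * (1 - z ^ 2) * G z ^ 2) by now apply Rmult_le_pos.
      nra. }
  (* the weight of N vanishes at r = 0 *)
  assert (HNr : 0 <= N r).
  { destruct Hz as [-> | Hz]; [unfold N; lra|].
    destruct (Req_dec r 0) as [-> | Hr0]; [unfold N; lra|].
    assert (Hu1 : u1 r = 0).
    { apply Rmult_integral in Hz as [H | H]; [| exact H]. rewrite H in Hbig. lra. }
    assert (H2 : 2 <= u r ^ 2).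
    { apply Rnot_lt_le. intros H2.
      destruct (larger_value_on_the_right _ r _ (1 - r)
        (product_derivative r Hr)) as [y [Hy Hy']].
      - destruct (Hu r Hr) as [_ [_ U3]]. specialize (U3 ltac:(lra)).
        rewrite Hu1 in *.
        assert (E : (1 - r ^ 2) * u2 r = 2 * u r - u r ^ 3) by lra.
        replace (0 ^ 2 + u r * u2 r)
          with (u r * ((1 - r ^ 2) * u2 r) / (1 - r ^ 2)) by (field; apply Rgt_not_eq; nra).
        rewrite E. apply Rdiv_lt_0_compat; [| nra].
        replace (u r * (2 * u r - u r ^ 3)) with (u r ^ 2 * (2 - u r ^ 2)) by ring.
        apply Rmult_lt_0_compat; lra.
      - lra.
      - cbv beta in Hy'. rewrite Hz in Hy'.
        assert (u y * u1 y < 0) by (apply Hneg; lra). lra. }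
    unfold N. replace (G r) with (r * u r ^ 2 * (u r ^ 2 - 2) / 4)
      by (unfold G; rewrite Hu1; field).
    apply Rmult_le_pos; [apply Rmult_le_pos; [apply pow_le; lra | apply pow2_ge_0]|].
    apply pow_le. assert (0 <= r * u r ^ 2) by (apply Rmult_le_pos; lra).
    assert (0 <= r * u r ^ 2 * (u r ^ 2 - 2)) by (apply Rmult_le_pos; lra). lra. }
  assert (HG : forall x, r < x < 1 -> G x = 0).
  { intros x Hx.
    assert (N r <= N x) by (apply HN; lra).
    assert (N x <= N 1) by (apply HN; lra).
    assert (N 1 = 0) by (unfold N; ring).
    assert (Hx0 : N x = 0) by lra. unfold N in Hx0.
    apply Rmult_integral in Hx0 as [Hx0 | Hx0].
    - exfalso. assert (0 < x ^ 5 * (1 - x ^ 2) ^ 2); [| lra].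
      apply Rmult_lt_0_compat; apply pow_lt; nra.
    - destruct (Req_dec (G x) 0) as [| Hn]; [assumption|].
      now apply (pow_nonzero _ 3) in Hn. }
  set (x := (r + 1) / 2). assert (Hx : r < x < 1) by (unfold x; lra).
  destruct (pohozaev_density_derivative x ltac:(lra)) as [l [Hl Hid]].
  specialize (Hid ltac:(lra)).
  assert (Hl0 : is_derive G x 0).
  { apply (is_derive_ext_loc (fun _ => 0)).
    - assert (He : 0 < (1 - r) / 2) by lra.
      exists (mkposreal _ He). intros y Hy. symmetry. apply HG.
      apply Rabs_lt_between' in Hy. simpl in Hy. unfold x in Hy. lra.
    - apply (is_derive_const (V := R_NormedModule)). }
  rewrite <- (is_derive_unique _ _ _ Hl), (is_derive_unique _ _ _ Hl0),
    (HG x Hx) in Hid.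
  assert (u x * u1 x < 0) by (apply Hneg; lra). lra.
Qed.

End Interior.

(** Uniqueness applies on every [[x, 1]] with [0 < x]; the point [0] follows by
    continuity. *)
Lemma constant_of_equilibrium_at_one (u u1 u2 : R -> R) :
  solves_on 0 1 u u1 u2 -> u 1 ^ 3 = 2 * u 1 ->
  forall x, 0 <= x <= 1 -> u x = u 1.
Proof.
  intros Hu Hk.
  assert (Hpos : forall x, 0 < x <= 1 -> u x = u 1).
  { intros x Hx.
    apply (unique_left_of_one x 1 u u1 u2 (fun _ => u 1) (fun _ => 0) (fun _ => 0));
      try lra.
    - apply (solves_on_sub 0 1); [lra | lra | exact Hu].
    - now apply solves_on_const. }
  intros x Hx. destruct (Req_dec x 0) as [-> | H0]; [| apply Hpos; lra].
  destruct (Hu 0 ltac:(lra)) as [U1 _]. apply is_derive_continuity_pt in U1.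
  apply NNPP. intros Hne.
  assert (He : 0 < Rabs (u 1 - u 0)) by (apply Rabs_pos_lt; lra).
  destruct (U1 _ He) as [d [Hd Hcd]].
  assert (0 < Rmin 1 (d / 2)) by (apply Rmin_glb_lt; lra).
  assert (Rmin 1 (d / 2) <= 1) by apply Rmin_l.
  assert (Rmin 1 (d / 2) <= d / 2) by apply Rmin_r.
  assert (H' : R_dist (u (Rmin 1 (d / 2))) (u 0) < Rabs (u 1 - u 0)).
  { apply Hcd. split; [split; [exact I | lra]|].
    simpl. unfold R_dist. rewrite Rabs_right; lra. }
  rewrite Hpos in H' by lra. unfold R_dist in H'. lra.
Qed.

Lemma large_value_at_one (u u1 u2 : R -> R) :
  solves_on 0 1 u u1 u2 ->
  (exists x y, 0 <= x <= 1 /\ 0 <= y <= 1 /\ u x <> u y) ->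
  2 < u 1 ^ 2.
Proof.
  intros Hu [x [y [Hx [Hy Hxy]]]]. apply Rnot_le_lt. intros H.
  assert (Hk : u 1 ^ 3 = 2 * u 1).
  { destruct (Req_dec (u 1) 0) as [-> | Hne]; [ring|].
    assert (2 <= u 1 ^ 2) by now apply (no_small_value_at_one u u1 u2).
    replace (u 1 ^ 3) with (u 1 ^ 2 * u 1) by ring.
    replace (u 1 ^ 2) with 2 by lra. reflexivity. }
  apply Hxy. rewrite (constant_of_equilibrium_at_one u u1 u2 Hu Hk x Hx).
  now rewrite (constant_of_equilibrium_at_one u u1 u2 Hu Hk y Hy).
Qed.

(** * Outside the light cone *)

Section Exterior.
Variables (s : R) (u u1 u2 : R -> R).
Hypothesis (Hs : 1 <= s) (Hu : solves_on 1 s u u1 u2) (Hb : sqrt 2 < u 1).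

(** Positivity of [B] is the Riccati inequality [x u' > (u ^ 2 - 2) / 4]. *)
Let B x := x * u1 x - (u x ^ 2 - 2) / 4.

Lemma sqrt_two_bounds : sqrt 2 ^ 2 = 2 /\ 1.4 < sqrt 2.
Proof.
  split; [apply pow2_sqrt; lra|].
  rewrite <- (sqrt_Rsqr 1.4) by lra. apply sqrt_lt_1; unfold Rsqr; lra.
Qed.

Lemma barrier_derivative (x : R) : 1 <= x <= s ->
  is_derive B x (u1 x + x * u2 x - u x * u1 x / 2).
Proof.
  intros Hx. destruct (Hu x Hx) as [U1 [U2 _]].
  unfold B. auto_derive; [repeat split; eexists; eassumption|].
  rewrite_derive U1. rewrite_derive U2. field.
Qed.

Lemma increasing_under_barrier (r : R) : 1 <= r <= s ->
  (forall x, 1 <= x < r -> 0 < B x /\ 0 < u x - sqrt 2) -> u 1 <= u r.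
Proof.
  intros Hr H. apply (nondecreasing_of_derivative u u1); [lra | |].
  - intros x Hx. apply Hu. lra.
  - intros x Hx. destruct (H x ltac:(lra)) as [HB Hx2]. unfold B in HB.
    destruct sqrt_two_bounds. nra.
Qed.

(** [B] and [u - sqrt 2] are positive at [1]. At a first point [r] where one of
    them vanishes, [u r >= u 1 > sqrt 2], so it is [B] that vanishes; the
    equation then gives [B' r > 0], although [B] is positive before [r]. The
    constant [1 / 4] is small enough for the inequality at [1], where
    [u' = u (u ^ 2 - 2) / 2], and for the sign of [B' r]. *)
Lemma riccati_barrier : forall x, 1 <= x < s -> 0 < B x /\ 0 < u x - sqrt 2.
Proof.
  destruct sqrt_two_bounds as [Hsq Hsq'].
  assert (HB1 : 0 < B 1).
  { destruct (Hu 1 ltac:(lra)) as [_ [_ H]]. specialize (H Rlt_0_1).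
    unfold B. assert (H1 : u1 1 = u 1 * (u 1 ^ 2 - 2) / 2) by lra.
    rewrite H1.
    replace (1 * (u 1 * (u 1 ^ 2 - 2) / 2) - (u 1 ^ 2 - 2) / 4)
      with ((u 1 ^ 2 - 2) * (2 * u 1 - 1) / 4) by field.
    apply Rdiv_lt_0_compat; [| lra]. apply Rmult_lt_0_compat; nra. }
  destruct (first_joint_zero B (fun x => u x - sqrt 2) 1 s)
    as [r [Hr [Hpos Hz]]].
  { exact Hs. }
  { intros x Hx. apply (is_derive_continuity_pt _ _ _ (barrier_derivative x Hx)). }
  { intros x Hx. destruct (Hu x Hx) as [U1 _].
    apply continuity_pt_minus; [now apply is_derive_continuity_pt in U1|].
    now apply continuity_pt_const. }
  { exact HB1. }
  { lra. }
  assert (Hru := increasing_under_barrier r Hr Hpos).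
  destruct Hz as [-> | [Hz | Hz]]; [exact Hpos | exfalso | exfalso; lra].
  assert (Hr1 : 1 < r).
  { destruct (Req_dec r 1) as [-> |]; [| lra]. exfalso.
    unfold B in Hz, HB1. lra. }
  destruct (Hu r Hr) as [_ [_ U3]]. specialize (U3 ltac:(lra)).
  assert (Hd : 0 < u1 r + r * u2 r - u r * u1 r / 2).
  { set (q := u r ^ 2 - 2). assert (Hq : 0 < q) by (unfold q; nra).
    assert (E1 : u1 r = q / (4 * r)).
    { apply Rmult_eq_reg_l with r; [| lra].
      replace (r * (q / (4 * r))) with (q / 4) by (field; lra).
      unfold B in Hz. unfold q. lra. }
    assert (E2 : (r ^ 2 - 1) * u2 r = (2 / r - 4 * r) * u1 r + u r * q)
      by (unfold q; lra).
    assert (Hr2 : 0 < r ^ 2 - 1) by nra.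
    apply Rmult_lt_reg_l with ((r ^ 2 - 1) * r); [nra|]. rewrite Rmult_0_r.
    replace ((r ^ 2 - 1) * r * (u1 r + r * u2 r - u r * u1 r / 2))
      with ((r ^ 2 - 1) * r * u1 r * (1 - u r / 2) + r ^ 2 * ((r ^ 2 - 1) * u2 r))
      by field.
    rewrite E2, E1.
    replace ((r ^ 2 - 1) * r * (q / (4 * r)) * (1 - u r / 2)
        + r ^ 2 * ((2 / r - 4 * r) * (q / (4 * r)) + u r * q))
      with (q * (r ^ 2 * (7 / 8 * u r - 3 / 4) + u r / 8 + 1 / 4)) by (field; lra).
    apply Rmult_lt_0_compat; [exact Hq|]. nra. }
  assert (Hdn := barrier_derivative r Hr).
  (* the reflected function turns a smaller value on the left into a larger one
     on the right *)
  assert (Hrefl : is_derive (fun y => - B (- y)) (- r)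
                    (u1 r + r * u2 r - u r * u1 r / 2)).
  { rewrite <- (Ropp_involutive r) in Hdn at 1.
    auto_derive; [eexists; exact Hdn|].
    rewrite_derive Hdn. ring. }
  destruct (larger_value_on_the_right _ _ _ (r - 1) Hrefl Hd) as [y [Hy Hy']].
  { lra. }
  cbv beta in Hy'. rewrite Ropp_involutive in Hy'.
  destruct (Hpos (- y) ltac:(lra)). lra.
Qed.

(** [1 / (u - sqrt 2)] stays positive but loses at least [ln x / 4], by
    [(u - sqrt 2) ^ 2 <= u ^ 2 - 2]. *)
Lemma lifespan_bound : ln s < 4 / (u 1 - sqrt 2).
Proof.
  destruct sqrt_two_bounds as [Hsq Hsq'].
  assert (Hge : forall r, 1 <= r <= s -> u 1 <= u r).
  { intros r Hr. apply increasing_under_barrier; [exact Hr|].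
    intros x Hx. apply riccati_barrier. lra. }
  assert (H : - (/ (u 1 - sqrt 2) + / 4 * ln 1)
              <= - (/ (u s - sqrt 2) + / 4 * ln s)).
  { apply (nondecreasing_of_derivative
      (fun x => - (/ (u x - sqrt 2) + / 4 * ln x))
      (fun x => u1 x / (u x - sqrt 2) ^ 2 - / 4 * / x)); [exact Hs | |].
    - intros x Hx. destruct (Hu x Hx) as [U1 _]. specialize (Hge x Hx).
      auto_derive.
      + repeat split; try lra. eexists; eassumption.
      + rewrite_derive U1. field. lra.
    - intros x Hx. destruct (riccati_barrier x ltac:(lra)) as [HB Hpos].
      unfold B in HB. specialize (Hge x ltac:(lra)).
      apply Rmult_le_reg_r with (x * (u x - sqrt 2) ^ 2).
      { apply Rmult_lt_0_compat; [lra|]. apply pow_lt. lra. }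
      rewrite Rmult_0_l.
      replace ((u1 x / (u x - sqrt 2) ^ 2 - / 4 * / x) * (x * (u x - sqrt 2) ^ 2))
        with (x * u1 x - (u x - sqrt 2) ^ 2 / 4) by (field; lra).
      nra. }
  rewrite ln_1 in H. specialize (Hge s ltac:(lra)).
  assert (0 < / (u s - sqrt 2)) by (apply Rinv_0_lt_compat; lra).
  unfold Rdiv. lra.
Qed.

End Exterior.

Lemma finite_lifespan (u u1 u2 : R -> R) (s : R) : 1 <= s ->
  solves_on 1 s u u1 u2 -> 2 < u 1 ^ 2 ->
  s < exp (4 / (Rabs (u 1) - sqrt 2)).
Proof.
  intros Hs Hu Hb. rewrite <- (exp_ln s) by lra. apply exp_increasing.
  destruct sqrt_two_bounds as [Hsq Hsq'].
  destruct (Rcase_abs (u 1)) as [Hn | Hp].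
  - rewrite Rabs_left by exact Hn.
    apply (lifespan_bound s _ _ _ Hs (solves_on_opp _ _ _ _ _ Hu)). nra.
  - rewrite Rabs_right by exact Hp.
    apply (lifespan_bound s _ _ _ Hs Hu). nra.
Qed.

(** * Derivatives relative to a set *)

(** Differentiability in the form without quotient, in which restriction,
    gluing and extension are immediate. *)
Definition expands (J : R -> Prop) (f : R -> R) (l x0 : R) : Prop :=
  forall eps, 0 < eps -> exists del, 0 < del /\
    forall x, J x -> Rabs (x - x0) < del ->
      Rabs (f x - f x0 - l * (x - x0)) <= eps * Rabs (x - x0).

Lemma quotient_error (d l t : R) : t <> 0 ->
  Rabs (d - l * t) = Rabs (d / t - l) * Rabs t.
Proof. intros Ht. rewrite <- Rabs_mult. f_equal. field. exact Ht. Qed.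

Lemma D_in_expands (f d : R -> R) (J : R -> Prop) (x0 : R) :
  D_in f d J x0 <-> expands J f (d x0) x0.
Proof.
  split.
  - intros H eps He. destruct (H eps He) as [del [Hd H']].
    exists del. split; [exact Hd|]. intros x Jx Hx.
    destruct (Req_dec x x0) as [-> | Hne].
    + rewrite !Rminus_diag, Rmult_0_r, Rminus_0_r, Rabs_R0. lra.
    + rewrite quotient_error by lra. apply Rmult_le_compat_r; [apply Rabs_pos|].
      left. apply (H' x). split; [split; [exact Jx | now apply not_eq_sym] | exact Hx].
  - intros H eps He. destruct (H (eps / 2) ltac:(lra)) as [del [Hd H']].
    exists del. split; [exact Hd|]. intros x [[Jx Hne] Hx].
    specialize (H' x Jx Hx). rewrite quotient_error in H' by lra.
    assert (0 < Rabs (x - x0)) by (apply Rabs_pos_lt; lra).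
    apply Rmult_le_reg_r in H'; [| assumption].
    simpl. unfold R_dist. lra.
Qed.

Lemma is_derive_expands (f : R -> R) (l x0 : R) :
  is_derive f x0 l <-> expands (fun _ => True) f l x0.
Proof.
  rewrite is_derive_Reals. split.
  - intros H eps He. destruct (H eps He) as [del H'].
    exists del. split; [apply cond_pos|]. intros x _ Hx.
    destruct (Req_dec x x0) as [-> | Hne].
    + rewrite !Rminus_diag, Rmult_0_r, Rminus_0_r, Rabs_R0. lra.
    + rewrite quotient_error by lra. apply Rmult_le_compat_r; [apply Rabs_pos|].
      left. specialize (H' (x - x0) ltac:(lra) Hx).
      now replace (x0 + (x - x0)) with x in H' by ring.
  - intros H eps He. destruct (H (eps / 2) ltac:(lra)) as [del [Hd H']].
    exists (mkposreal del Hd). intros h Hne Hh. simpl in Hh.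
    specialize (H' (x0 + h) I). replace (x0 + h - x0) with h in H' by ring.
    specialize (H' Hh). rewrite quotient_error in H' by lra.
    assert (0 < Rabs h) by now apply Rabs_pos_lt.
    apply Rmult_le_reg_r in H'; [| assumption]. lra.
Qed.

(** This is used both to restrict a derivative to a smaller set and to glue
    functions that coincide near a point. *)
Lemma D_in_local (f g d e : R -> R) (J K : R -> Prop) (x0 del : R) :
  0 < del -> (forall x, K x -> Rabs (x - x0) < del -> J x /\ g x = f x) ->
  K x0 -> e x0 = d x0 -> D_in f d J x0 -> D_in g e K x0.
Proof.
  intros Hdel Hloc Kx0 He H. apply D_in_expands. apply D_in_expands in H.
  intros eps Heps. destruct (H eps Heps) as [del' [Hdel' H']].
  exists (Rmin del del'). split; [now apply Rmin_glb_lt|].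
  intros x Kx Hx.
  assert (Rmin del del' <= del) by apply Rmin_l.
  assert (Rmin del del' <= del') by apply Rmin_r.
  destruct (Hloc x Kx ltac:(lra)) as [Jx ->].
  destruct (Hloc x0 Kx0) as [_ ->].
  { rewrite Rminus_diag, Rabs_R0. exact Hdel. }
  rewrite He. apply H'; [exact Jx | lra].
Qed.

Lemma is_derive_D_in (f d : R -> R) (J : R -> Prop) (x0 : R) :
  is_derive f x0 (d x0) -> D_in f d J x0.
Proof.
  intros H. apply D_in_expands. apply is_derive_expands in H.
  intros eps Heps. destruct (H eps Heps) as [del [Hdel H']].
  exists del. split; [exact Hdel|]. intros x _. now apply H'.
Qed.

(** Continue [f] by its tangent lines at the two endpoints; one-sided
    derivatives become two-sided ones. *)
Lemma differentiable_extension (f d : R -> R) (a b : R) : a < b ->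
  (forall x, a <= x <= b -> D_in f d (fun y => a <= y <= b) x) ->
  exists g, forall x, a <= x <= b -> g x = f x /\ is_derive g x (d x).
Proof.
  intros Hab H.
  set (g := fun x => if Rlt_dec x a then f a + d a * (x - a)
                     else if Rlt_dec b x then f b + d b * (x - b) else f x).
  assert (Hin : forall x, a <= x <= b -> g x = f x).
  { intros x Hx. unfold g. destruct (Rlt_dec x a); [lra|].
    destruct (Rlt_dec b x); [lra | reflexivity]. }
  exists g. intros x Hx. split; [now apply Hin|].
  apply is_derive_expands. intros eps Heps.
  assert (Hx' := H x Hx). apply D_in_expands in Hx'.
  destruct (Hx' eps Heps) as [del [Hdel H']].
  set (del1 := if Req_dec_T x a then del else x - a).
  set (del2 := if Req_dec_T x b then del else b - x).
  assert (H1 : 0 < del1) by (unfold del1; destruct (Req_dec_T x a); lra).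
  assert (H2 : 0 < del2) by (unfold del2; destruct (Req_dec_T x b); lra).
  exists (Rmin del (Rmin del1 del2)).
  split; [now repeat apply Rmin_glb_lt|]. intros y _ Hy.
  assert (Rmin del (Rmin del1 del2) <= del) by apply Rmin_l.
  assert (Rmin del (Rmin del1 del2) <= Rmin del1 del2) by apply Rmin_r.
  assert (Rmin del1 del2 <= del1) by apply Rmin_l.
  assert (Rmin del1 del2 <= del2) by apply Rmin_r.
  assert (0 <= eps * Rabs (y - x)).
  { apply Rmult_le_pos; [lra | apply Rabs_pos]. }
  rewrite (Hin x Hx). unfold g. destruct (Rlt_dec y a) as [Hya |].
  - assert (x = a) as ->.
    { unfold del1 in *. destruct (Req_dec_T x a); [assumption|].
      rewrite Rabs_left in Hy; lra. }
    replace (f a + d a * (y - a) - f a - d a * (y - a)) with 0 by ring.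
    now rewrite Rabs_R0.
  - destruct (Rlt_dec b y) as [Hyb |].
    + assert (x = b) as ->.
      { unfold del2 in *. destruct (Req_dec_T x b); [assumption|].
        rewrite Rabs_right in Hy; lra. }
      replace (f b + d b * (y - b) - f b - d b * (y - b)) with 0 by ring.
      now rewrite Rabs_R0.
    + apply H'; lra.
Qed.

Lemma D_in_unique (f d e : R -> R) (a b x : R) : a < b -> a <= x <= b ->
  D_in f d (fun y => a <= y <= b) x -> D_in f e (fun y => a <= y <= b) x ->
  d x = e x.
Proof.
  intros Hab Hx Hd He. apply (single_limit _ _ _ _ _ ) with (2 := Hd) (3 := He).
  intros alp Halp.
  destruct (Rlt_dec x b) as [Hxb | Hxb].
  - exists (Rmin b (x + alp / 2)).
    assert (x < Rmin b (x + alp / 2)) by (apply Rmin_glb_lt; lra).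
    assert (Rmin b (x + alp / 2) <= b) by apply Rmin_l.
    assert (Rmin b (x + alp / 2) <= x + alp / 2) by apply Rmin_r.
    split; [split; lra|]. simpl. unfold R_dist. apply Rabs_def1; lra.
  - exists (Rmax a (x - alp / 2)).
    assert (Rmax a (x - alp / 2) < x) by (apply Rmax_lub_lt; lra).
    assert (a <= Rmax a (x - alp / 2)) by apply Rmax_l.
    assert (x - alp / 2 <= Rmax a (x - alp / 2)) by apply Rmax_r.
    split; [split; lra|]. simpl. unfold R_dist. apply Rabs_def1; lra.
Qed.

(** * Families of successive derivatives *)

(** A smooth solution given by the sequence of its derivatives, the solution
    itself being [D 0]. *)
Definition solution_family (J : R -> Prop) (D : nat -> R -> R) : Prop :=
  (forall n x, J x -> D_in (D n) (D (S n)) J x) /\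
  forall x, J x -> x <> 0 ->
    (1 - x ^ 2) * D 2%nat x + (2 / x - 4 * x) * D 1%nat x
      - 2 * D 0%nat x + D 0%nat x ^ 3 = 0.

Lemma smooth_solution_family (J : R -> Prop) (U : R -> R) :
  smooth_solution J U <->
  exists D, solution_family J D /\ forall x, J x -> D 0%nat x = U x.
Proof.
  split.
  - intros [D [[H0 HS] Hode]]. exists D. split; [split|]; auto.
    intros x Jx Hx. rewrite (H0 x Jx). now apply Hode.
  - intros [D [[HS Hode] H0]]. exists D. split; [split|]; auto.
    intros x Jx Hx. rewrite <- (H0 x Jx). now apply Hode.
Qed.

Lemma solution_family_sub (J K : R -> Prop) (D : nat -> R -> R) :
  (forall x, K x -> J x) -> solution_family J D -> solution_family K D.
Proof.
  intros HKJ [HS Hode]. split; [| auto]. intros n x Kx.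
  apply (D_in_local (D n) _ (D (S n)) _ J _ _ 1); auto; lra.
Qed.

Lemma solution_family_solves (a b : R) (D : nat -> R -> R) : a < b ->
  solution_family (fun x => a <= x <= b) D ->
  exists u u1 u2, solves_on a b u u1 u2 /\
    forall x, a <= x <= b -> u x = D 0%nat x /\ u1 x = D 1%nat x.
Proof.
  intros Hab [HS Hode].
  destruct (differentiable_extension (D 0%nat) (D 1%nat) a b Hab (HS 0%nat)) as [u Hu].
  destruct (differentiable_extension (D 1%nat) (D 2%nat) a b Hab (HS 1%nat)) as [u1 Hu1].
  exists u, u1, (D 2%nat). split.
  - intros x Hx. destruct (Hu x Hx) as [E0 U1]. destruct (Hu1 x Hx) as [E1 U2].
    rewrite E1. split; [exact U1|]. split; [exact U2|].
    intros Hp. rewrite E0. apply Hode; lra.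
  - intros x Hx. split; [apply Hu, Hx | apply Hu1, Hx].
Qed.

Lemma derivatives_agree (a b : R) (D F : nat -> R -> R) : a < b ->
  (forall n x, a <= x <= b -> D_in (D n) (D (S n)) (fun y => a <= y <= b) x) ->
  (forall n x, a <= x <= b -> D_in (F n) (F (S n)) (fun y => a <= y <= b) x) ->
  (forall x, a <= x <= b -> D 0%nat x = F 0%nat x) ->
  forall n x, a <= x <= b -> D n x = F n x.
Proof.
  intros Hab HD HF H0 n. induction n as [| n IH]; [exact H0|].
  intros x Hx. apply (D_in_unique (D n) _ _ a b); auto.
  apply (D_in_local (F n) _ (F (S n)) _ (fun y => a <= y <= b) _ _ 1); auto; lra.
Qed.

(** To the right of [1] the functions agree by [unique_right_of_one]; the
    higher derivatives follow since they are determined by the function. *)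
Lemma solution_families_agree (s : R) (D F : nat -> R -> R) : 1 < s ->
  solution_family (fun x => 0 <= x <= s) D ->
  solution_family (fun x => 0 <= x <= s) F ->
  (forall x, 0 <= x <= 1 -> D 0%nat x = F 0%nat x) ->
  forall n x, 0 <= x <= s -> D n x = F n x.
Proof.
  intros Hs HD HF H0.
  apply derivatives_agree; [lra | apply HD | apply HF |].
  intros x Hx. destruct (Rle_dec x 1) as [Hx1 | Hx1]; [apply H0; lra|].
  destruct (solution_family_solves 1 s D Hs) as [u [u1 [u2 [Hu Eu]]]].
  { revert HD. apply solution_family_sub. intros y Hy. lra. }
  destruct (solution_family_solves 1 s F Hs) as [v [v1 [v2 [Hv Ev]]]].
  { revert HF. apply solution_family_sub. intros y Hy. lra. }
  destruct (Eu x ltac:(lra)) as [<- _]. destruct (Ev x ltac:(lra)) as [<- _].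
  apply (unique_right_of_one 1 s u u1 u2 v v1 v2); auto; try lra.
  destruct (Eu 1 ltac:(lra)) as [-> _]. destruct (Ev 1 ltac:(lra)) as [-> _].
  apply H0. lra.
Qed.

(** * Power series solutions *)

(** Recursion in which each term may depend on all previous ones: [table n]
    holds the terms up to [n] and is constant from then on. *)
Lemma sequence_of_recursion (y : R) (step : nat -> (nat -> R) -> R) :
  (forall n a b, (forall k, (k <= n)%nat -> a k = b k) -> step n a = step n b) ->
  exists a : nat -> R, a 0%nat = y /\ forall n, a (S n) = step n a.
Proof.
  intros Hloc.
  set (table := fix table n : nat -> R :=
    match n with
    | 0%nat => fun _ => y
    | S m => fun k => if Nat.leb k m then table m k else step m (table m)
    end).
  assert (Hst : forall n k, (k <= n)%nat -> table n k = table k k).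
  { induction n as [| n IH]; intros k Hk.
    - now replace k with 0%nat by lia.
    - destruct (Nat.eq_dec k (S n)) as [-> | Hne]; [reflexivity|].
      simpl. replace (Nat.leb k n) with true
        by (symmetry; apply Nat.leb_le; lia).
      apply IH. lia. }
  exists (fun n => table n n). split; [reflexivity|]. intros n.
  change ((if Nat.leb (S n) n then table n (S n) else step n (table n))
          = step n (fun m => table m m)).
  replace (Nat.leb (S n) n) with false
    by (symmetry; apply Nat.leb_gt; lia).
  apply Hloc. intros k Hk. now apply Hst.
Qed.

Lemma PS_mult_local (a b c d : nat -> R) (n : nat) :
  (forall k, (k <= n)%nat -> a k = c k) ->
  (forall k, (k <= n)%nat -> b k = d k) -> PS_mult a b n = PS_mult c d n.
Proof.
  intros Hac Hbd. unfold PS_mult. apply sum_eq. intros k Hk.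
  rewrite Hac, Hbd by lia. reflexivity.
Qed.

Lemma PS_mult_bound (a b : nat -> R) (A B C : R) (n : nat) :
  0 <= A -> 0 <= C ->
  (forall k, (k <= n)%nat -> Rabs (a k) <= A * C ^ k) ->
  (forall k, (k <= n)%nat -> Rabs (b k) <= B * C ^ k) ->
  Rabs (PS_mult a b n) <= INR (S n) * (A * B * C ^ n).
Proof.
  intros HA HC Ha Hb. unfold PS_mult.
  apply Rle_trans with (1 := Rsum_abs _ _).
  rewrite Rmult_comm, <- sum_cte. apply sum_Rle. intros k Hk.
  rewrite Rabs_mult.
  replace (A * B * C ^ n) with ((A * C ^ k) * (B * C ^ (n - k))).
  - apply Rmult_le_compat; try apply Rabs_pos; [apply Ha | apply Hb]; lia.
  - replace n with (k + (n - k))%nat at 2 by lia. rewrite pow_add. ring.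
Qed.

Definition cube (a : nat -> R) : nat -> R := PS_mult (PS_mult a a) a.

Lemma cube_local (a b : nat -> R) (n : nat) :
  (forall k, (k <= n)%nat -> a k = b k) -> cube a n = cube b n.
Proof.
  intros H. apply PS_mult_local; [| exact H]. intros k Hk.
  apply PS_mult_local; intros j Hj; apply H; lia.
Qed.

(** There are at most [(n + 1) ^ 2] triples of indices with sum [n]. *)
Lemma cube_bound (a : nat -> R) (M C : R) (n : nat) : 0 <= M -> 0 <= C ->
  (forall k, (k <= n)%nat -> Rabs (a k) <= M * C ^ k) ->
  Rabs (cube a n) <= INR (S n) ^ 2 * (M ^ 3 * C ^ n).
Proof.
  intros HM HC Ha.
  assert (Hn : 0 <= INR (S n)) by apply pos_INR.
  replace (INR (S n) ^ 2 * (M ^ 3 * C ^ n))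
    with (INR (S n) * (INR (S n) * M ^ 2 * M * C ^ n)) by ring.
  apply PS_mult_bound; [| exact HC | | exact Ha].
  - apply Rmult_le_pos; [exact Hn | apply pow2_ge_0].
  - intros k Hk.
    apply Rle_trans with (INR (S k) * (M * M * C ^ k)).
    + apply PS_mult_bound; auto; intros j Hj; apply Ha; lia.
    + replace (INR (S n) * M ^ 2 * C ^ k) with (INR (S n) * (M * M * C ^ k)) by ring.
      apply Rmult_le_compat_r.
      * apply Rmult_le_pos; [nra | now apply pow_le].
      * apply le_INR. lia.
Qed.

(** After multiplication by [x] the equation has polynomial coefficients. For
    [u = sum a_n h ^ n], [h = x - r], this is the coefficient of [h ^ n] without
    the contributions of [a_(n+1)] and [a_(n+2)]. *)
Definition lower_terms (r : R) (a : nat -> R) (n : nat) : R :=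
  r * (cube a n - (INR n + 1) * (3 * INR n + 2) * a n) +
  match n with
  | 0%nat => 0
  | S m => cube a m - (INR m + 1) * (INR m + 2) * a m
  end.

Lemma lower_terms_local (r : R) (a b : nat -> R) (n : nat) :
  (forall k, (k <= n)%nat -> a k = b k) -> lower_terms r a n = lower_terms r b n.
Proof.
  intros H. unfold lower_terms. rewrite (H n) by lia.
  rewrite (cube_local a b n H). f_equal. destruct n as [| m]; [reflexivity|].
  rewrite (H m) by lia. rewrite (cube_local a b m); [reflexivity|].
  intros k Hk. apply H. lia.
Qed.

Lemma lower_terms_bound (r M C : R) (a : nat -> R) (n : nat) :
  1 <= r -> 1 <= M -> 1 <= C ->
  (forall k, (k <= n)%nat -> Rabs (a k) <= M * C ^ k) ->
  Rabs (lower_terms r a n) <= (4 * r + 2) * M ^ 3 * ((INR n + 1) ^ 2 * C ^ n).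
Proof.
  intros Hr HM HC Ha.
  assert (HM3 : M <= M ^ 3) by nra.
  assert (Hone : forall k, (k <= n)%nat ->
    Rabs (cube a k) <= M ^ 3 * ((INR n + 1) ^ 2 * C ^ n) /\
    forall p, 0 <= p -> p <= (INR n + 1) ^ 2 ->
      Rabs (p * a k) <= M ^ 3 * ((INR n + 1) ^ 2 * C ^ n)).
  { intros k Hk.
    assert (Hkn : INR k <= INR n) by (apply le_INR; lia).
    assert (Hk0 : 0 <= INR k) by apply pos_INR.
    assert (HCk : 0 < C ^ k) by (apply pow_lt; lra).
    assert (HCkn : C ^ k <= C ^ n) by (apply Rle_pow; [lra | lia]).
    split.
    - apply Rle_trans with (INR (S k) ^ 2 * (M ^ 3 * C ^ k)).
      { apply cube_bound; try lra. intros j Hj. apply Ha. lia. }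
      rewrite S_INR.
      replace (M ^ 3 * ((INR n + 1) ^ 2 * C ^ n))
        with ((INR n + 1) ^ 2 * (M ^ 3 * C ^ n)) by ring.
      apply Rmult_le_compat; [apply pow2_ge_0 | | |].
      + apply Rmult_le_pos; [apply pow_le|]; lra.
      + apply pow_incr. lra.
      + apply Rmult_le_compat_l; [apply pow_le; lra | exact HCkn].
    - intros p Hp Hpn. rewrite Rabs_mult, (Rabs_right p) by lra.
      replace (M ^ 3 * ((INR n + 1) ^ 2 * C ^ n))
        with ((INR n + 1) ^ 2 * (M ^ 3 * C ^ n)) by ring.
      apply Rmult_le_compat; [exact Hp | apply Rabs_pos | exact Hpn |].
      apply Rle_trans with (M * C ^ k); [now apply Ha|].
      apply Rmult_le_compat; lra. }
  set (T := M ^ 3 * ((INR n + 1) ^ 2 * C ^ n)) in *.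
  replace ((4 * r + 2) * M ^ 3 * ((INR n + 1) ^ 2 * C ^ n))
    with (r * (T + 3 * T) + (T + T)) by (unfold T; ring).
  assert (Hn0 : 0 <= INR n) by apply pos_INR.
  unfold lower_terms. apply Rle_trans with (1 := Rabs_triang _ _).
  apply Rplus_le_compat.
  - rewrite Rabs_mult, (Rabs_right r) by lra.
    apply Rmult_le_compat_l; [lra|].
    apply Rle_trans with (1 := Rabs_triang _ _). rewrite Rabs_Ropp.
    apply Rplus_le_compat; [now apply Hone|].
    replace ((INR n + 1) * (3 * INR n + 2) * a n)
      with (3 * ((INR n + 1) * (INR n + 2 / 3) * a n)) by field.
    rewrite Rabs_mult, (Rabs_right 3) by lra.
    apply Rmult_le_compat_l; [lra|]. apply Hone; [lia | nra | nra].
  - assert (HT : 0 <= T).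
    { apply Rle_trans with (Rabs (cube a n)); [apply Rabs_pos | now apply Hone]. }
    destruct n as [| m]; [rewrite Rabs_R0; lra|].
    apply Rle_trans with (1 := Rabs_triang _ _). rewrite Rabs_Ropp.
    assert (Hm0 : 0 <= INR m) by apply pos_INR.
    apply Rplus_le_compat; [apply Hone; lia|].
    apply Hone; [lia | nra | rewrite S_INR; nra].
Qed.

(** The vanishing of the coefficient of [h ^ n]. *)
Definition coefficient_recurrence (r : R) (a : nat -> R) : Prop :=
  forall n, r * (1 - r ^ 2) * ((INR n + 2) * (INR n + 1)) * a (S (S n))
    + ((1 - 3 * r ^ 2) * INR n + 2 - 4 * r ^ 2) * (INR n + 1) * a (S n)
    + lower_terms r a n = 0.

Lemma geometric_bound (a : nat -> R) (M C : R) :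
  Rabs (a 0%nat) <= M ->
  (forall n, (forall k, (k <= n)%nat -> Rabs (a k) <= M * C ^ k) ->
     Rabs (a (S n)) <= M * C ^ S n) ->
  forall n, Rabs (a n) <= M * C ^ n.
Proof.
  intros H0 HS n.
  assert (H : forall m k, (k <= m)%nat -> Rabs (a k) <= M * C ^ k).
  { induction m as [| m IH]; intros k Hk.
    - replace k with 0%nat by lia. simpl. lra.
    - destruct (Nat.eq_dec k (S m)) as [-> | Hne]; [now apply HS|].
      apply IH. lia. }
  now apply (H n).
Qed.

(** At the singular point the coefficient of [a_(n+2)] vanishes and that of
    [a_(n+1)] is [- 2 (n + 1) ^ 2]. This gain of [(n + 1) ^ 2] is exactly what
    [lower_terms_bound] loses, so a geometric bound propagates as soon as its
    ratio is at least [3 M ^ 2]. *)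
Lemma coefficients_at_one (y0 : R) :
  exists a M C, 0 <= M /\ 1 <= C /\ a 0%nat = y0 /\
    coefficient_recurrence 1 a /\ forall n, Rabs (a n) <= M * C ^ n.
Proof.
  destruct (sequence_of_recursion y0
    (fun n a => lower_terms 1 a n / (2 * (INR n + 1) ^ 2))) as [a [A0 AS]].
  { intros n a b H. now rewrite (lower_terms_local 1 a b n H). }
  set (M := 1 + Rabs y0). assert (0 <= Rabs y0) by apply Rabs_pos.
  assert (HM : 1 <= M) by (unfold M; lra).
  assert (HM2 : 1 <= 3 * M ^ 2) by nra.
  exists a, M, (3 * M ^ 2).
  split; [lra|]. split; [exact HM2|]. split; [exact A0|]. split.
  - intros n. rewrite (AS n). assert (0 <= INR n) by apply pos_INR. field. lra.
  - apply geometric_bound; [rewrite A0; unfold M; lra|].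
    intros n Ha. rewrite AS.
    assert (Hn : 0 <= INR n) by apply pos_INR.
    assert (Hn2 : 0 < (INR n + 1) ^ 2) by (apply pow_lt; lra).
    apply (lower_terms_bound 1 M) in Ha; try lra.
    rewrite Rabs_div, (Rabs_right (2 * _)) by lra.
    apply Rmult_le_reg_r with (2 * (INR n + 1) ^ 2); [lra|].
    unfold Rdiv. rewrite Rmult_assoc, Rinv_l, Rmult_1_r by lra.
    apply Rle_trans with (1 := Ha). right. simpl. ring.
Qed.

(** As at the singular point, with the gain [(n + 1) (n + 2)] now coming from the
    coefficient of [a_(n+2)]. *)
Lemma coefficients_at_regular_point (r y0 y1 : R) : 1 < r ->
  exists a M C, 0 <= M /\ 1 <= C /\ a 0%nat = y0 /\ a 1%nat = y1 /\
    coefficient_recurrence r a /\ forall n, Rabs (a n) <= M * C ^ n.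
Proof.
  intros Hr.
  set (p := r * (r ^ 2 - 1)). assert (Hp : 0 < p) by (unfold p; nra).
  set (q := fun n : nat =>
    ((1 - 3 * r ^ 2) * INR n + 2 - 4 * r ^ 2) * (INR n + 1)).
  destruct (sequence_of_recursion y0 (fun n a =>
      match n with
      | 0%nat => y1
      | S m => (q m * a (S m) + lower_terms r a m) / (p * ((INR m + 2) * (INR m + 1)))
      end)) as [a [A0 AS]].
  { intros [| m] a b H; [reflexivity|].
    rewrite (H (S m)) by lia. rewrite (lower_terms_local r a b m); [reflexivity|].
    intros k Hk. apply H. lia. }
  set (M := 1 + Rabs y0 + Rabs y1).
  assert (0 <= Rabs y0) by apply Rabs_pos.
  assert (0 <= Rabs y1) by apply Rabs_pos.
  assert (HM : 1 <= M) by (unfold M; lra).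
  set (K := (4 * r ^ 2 + 4 * r + 2) * M ^ 2 / p).
  assert (HK : 0 <= K).
  { apply Rmult_le_pos; [nra|]. left. now apply Rinv_0_lt_compat. }
  exists a, M, (1 + K).
  split; [lra|]. split; [lra|]. split; [exact A0|].
  split; [apply (AS 0%nat)|]. split.
  - intros n. rewrite (AS (S n)). assert (0 <= INR n) by apply pos_INR.
    unfold q, p. field. unfold p in Hp. repeat split; try lra; nra.
  - apply geometric_bound; [rewrite A0; unfold M; lra|].
    intros [| n] Ha; rewrite AS.
    { apply Rle_trans with M; [unfold M; lra|]. simpl. nra. }
    assert (Hn : 0 <= INR n) by apply pos_INR.
    assert (Ht : Rabs (lower_terms r a n)
        <= (4 * r + 2) * M ^ 3 * ((INR n + 1) ^ 2 * (1 + K) ^ n)).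
    { apply lower_terms_bound; try lra. intros k Hk. apply Ha. lia. }
    specialize (Ha (S n) (le_n _)).
    set (c := (1 + K) ^ n) in *.
    assert (Hc : 0 < c) by (apply pow_lt; lra).
    replace ((1 + K) ^ S n) with ((1 + K) * c) in Ha by (unfold c; simpl; ring).
    assert (Hq : Rabs (q n) <= 4 * r ^ 2 * (INR n + 1) ^ 2).
    { unfold q. rewrite Rabs_mult, (Rabs_right (INR n + 1)) by lra.
      replace (4 * r ^ 2 * (INR n + 1) ^ 2)
        with (4 * r ^ 2 * (INR n + 1) * (INR n + 1)) by ring.
      apply Rmult_le_compat_r; [lra|]. apply Rabs_le.
      assert (1 <= r ^ 2) by nra.
      assert (0 <= r ^ 2 * INR n) by (apply Rmult_le_pos; lra).
      split; nra. }
    assert (Hd : 0 < p * ((INR n + 2) * (INR n + 1))) by nra.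
    rewrite Rabs_div, (Rabs_right (p * _)) by lra.
    apply Rmult_le_reg_r with (1 := Hd).
    unfold Rdiv. rewrite Rmult_assoc, Rinv_l, Rmult_1_r by lra.
    apply Rle_trans with (1 := Rabs_triang _ _). rewrite Rabs_mult.
    set (m := (INR n + 1) ^ 2 * ((1 + K) * c)).
    assert (Hm : 0 <= m) by (apply Rmult_le_pos; [apply pow2_ge_0 | nra]).
    assert (H1 : Rabs (q n) * Rabs (a (S n)) <= 4 * r ^ 2 * M * m).
    { replace (4 * r ^ 2 * M * m)
        with (4 * r ^ 2 * (INR n + 1) ^ 2 * (M * ((1 + K) * c)))
        by (unfold m; ring).
      apply Rmult_le_compat; try apply Rabs_pos; assumption. }
    assert (H2 : Rabs (lower_terms r a n) <= (4 * r + 2) * M ^ 3 * m).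
    { apply Rle_trans with (1 := Ht). apply Rmult_le_compat_l.
      - apply Rmult_le_pos; [lra|]. apply pow_le. lra.
      - unfold m. apply Rmult_le_compat_l; [apply pow2_ge_0 | nra]. }
    assert (H3 : 4 * r ^ 2 * M * m <= 4 * r ^ 2 * M ^ 3 * m).
    { apply Rmult_le_compat_r; [exact Hm|]. apply Rmult_le_compat_l; nra. }
    assert (H4 : (4 * r ^ 2 + 4 * r + 2) * M ^ 3 * m = M * p * K * m)
      by (unfold K; field; lra).
    assert (H5 : M * p * K * m <= M * p * (1 + K) * m).
    { apply Rmult_le_compat_r; [exact Hm|]. apply Rmult_le_compat_l; nra. }
    assert (H6 : M * p * (1 + K) * m
        <= M * (1 + K) ^ S (S n) * (p * ((INR n + 2) * (INR n + 1)))).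
    { replace (M * (1 + K) ^ S (S n) * (p * ((INR n + 2) * (INR n + 1))))
        with (M * p * (1 + K) * ((INR n + 2) * (INR n + 1) * ((1 + K) * c)))
        by (unfold c; simpl; ring).
      apply Rmult_le_compat_l.
      - apply Rmult_le_pos; [| lra]. apply Rmult_le_pos; lra.
      - unfold m. apply Rmult_le_compat_r; nra. }
    lra.
Qed.

(** Half the natural radius suffices to absorb the factor [n + 1], by
    [n + 1 <= 2 ^ n]. *)
Lemma radius_of_geometric_bound (a : nat -> R) (A C x : R) : 0 < C -> 0 <= A ->
  (forall n, Rabs (a n) <= INR (S n) * (A * C ^ n)) ->
  Rabs x < / (2 * C) -> Rbar_lt (Rabs x) (CV_radius a).
Proof.
  intros HC HA Ha Hx. apply Rbar_lt_le_trans with (Finite (/ (2 * C))); [exact Hx|].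
  apply (CV_radius_bounded a). exists A. intros n.
  assert (Hpow : INR (S n) <= 2 ^ n).
  { clear. induction n as [| n IH]; [simpl; lra|].
    rewrite S_INR. change (2 ^ S n) with (2 * 2 ^ n).
    assert (1 <= INR (S n)) by (rewrite S_INR; assert (0 <= INR n) by apply pos_INR; lra).
    lra. }
  assert (Hi : 0 < / (2 * C)) by (apply Rinv_0_lt_compat; lra).
  rewrite Rabs_mult, (Rabs_right ((/ (2 * C)) ^ n)) by (apply Rle_ge, pow_le; lra).
  apply Rle_trans with (2 ^ n * (A * C ^ n) * (/ (2 * C)) ^ n).
  - apply Rmult_le_compat_r; [apply pow_le; lra|].
    apply Rle_trans with (1 := Ha n). apply Rmult_le_compat_r; [| exact Hpow].
    apply Rmult_le_pos; [exact HA | apply pow_le; lra].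
  - right. replace (2 ^ n * (A * C ^ n) * (/ (2 * C)) ^ n)
      with (A * (2 * C * / (2 * C)) ^ n) by (rewrite !Rpow_mult_distr; ring).
    rewrite Rinv_r, pow1 by lra. ring.
Qed.

Lemma power_series_solves (r h M C : R) (a : nat -> R) :
  0 <= M -> 1 <= C -> coefficient_recurrence r a ->
  (forall n, Rabs (a n) <= M * C ^ n) -> Rabs h < / (2 * C) ->
  (r + h) * (1 - (r + h) ^ 2) * PSeries (PS_derive (PS_derive a)) h
  + (2 - 4 * (r + h) ^ 2) * PSeries (PS_derive a) h
  - 2 * (r + h) * PSeries a h + (r + h) * PSeries a h ^ 3 = 0.
Proof.
  intros HM HC Hrec Ha Hh.
  assert (Hrad : Rbar_lt (Rabs h) (CV_radius a)).
  { apply (radius_of_geometric_bound a M C); try lra. intros n.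
    apply Rle_trans with (1 := Ha n).
    assert (0 <= M * C ^ n) by (apply Rmult_le_pos; [lra | apply pow_le; lra]).
    rewrite S_INR. assert (0 <= INR n) by apply pos_INR. nra. }
  assert (Hrad2 : Rbar_lt (Rabs h) (CV_radius (PS_mult a a))).
  { apply (radius_of_geometric_bound _ (M * M) C); try nra. intros n.
    apply PS_mult_bound; auto; lra. }
  assert (P0 : is_pseries a h (PSeries a h))
    by now apply PSeries_correct, CV_radius_inside.
  assert (P1 : is_pseries (PS_derive a) h (PSeries (PS_derive a) h)).
  { apply PSeries_correct, CV_radius_inside. now rewrite CV_radius_derive. }
  assert (P2 : is_pseries (PS_derive (PS_derive a)) h
                 (PSeries (PS_derive (PS_derive a)) h)).
  { apply PSeries_correct, CV_radius_inside. now rewrite !CV_radius_derive. }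
  assert (P3 : is_pseries (cube a) h (PSeries a h ^ 3)).
  { replace (PSeries a h ^ 3) with (PSeries a h * PSeries a h * PSeries a h) by ring.
    apply is_pseries_mult; auto. now apply is_pseries_mult. }
  set (Y0 := PSeries a h) in *. set (Y1 := PSeries (PS_derive a) h) in *.
  set (Y2 := PSeries (PS_derive (PS_derive a)) h) in *.
  assert (plus_ : forall b c lb lc, is_pseries b h lb -> is_pseries c h lc ->
            is_pseries (fun n => b n + c n) h (lb + lc))
    by (intros; now apply (is_pseries_plus (V := R_NormedModule))).
  assert (scal_ : forall c b l, is_pseries b h l ->
            is_pseries (fun n => c * b n) h (c * l)).
  { intros c b l Hb. apply (is_pseries_scal (V := R_NormedModule) c b h l);
      [apply Rmult_comm | exact Hb]. }
  assert (incr_ : forall b l, is_pseries b h l ->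
            is_pseries (fun n => match n with 0%nat => 0 | S m => b m end) h (h * l)).
  { intros b l Hb. exact (is_pseries_incr_1 (V := R_NormedModule) b h l Hb). }
  assert (Q2 := incr_ _ _ P2). assert (Q22 := incr_ _ _ Q2).
  assert (Q222 := incr_ _ _ Q22). assert (Q1 := incr_ _ _ P1).
  assert (Q11 := incr_ _ _ Q1). assert (Q0 := incr_ _ _ P0).
  assert (Q3 := incr_ _ _ P3).
  assert (Hsum :=
    plus_ _ _ _ _ (scal_ (r * (1 - r ^ 2)) _ _ P2)
   (plus_ _ _ _ _ (scal_ (1 - 3 * r ^ 2) _ _ Q2)
   (plus_ _ _ _ _ (scal_ (- 3 * r) _ _ Q22)
   (plus_ _ _ _ _ (scal_ (- 1) _ _ Q222)
   (plus_ _ _ _ _ (scal_ (2 - 4 * r ^ 2) _ _ P1)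
   (plus_ _ _ _ _ (scal_ (- 8 * r) _ _ Q1)
   (plus_ _ _ _ _ (scal_ (- 4) _ _ Q11)
   (plus_ _ _ _ _ (scal_ (- 2 * r) _ _ P0)
   (plus_ _ _ _ _ (scal_ (- 2) _ _ Q0)
   (plus_ _ _ _ _ (scal_ r _ _ P3) Q3)))))))))).
  cbv beta in Hsum.
  apply (is_pseries_ext _ (fun _ => 0)) in Hsum.
  2: { intros n. refine (eq_trans _ (Hrec n)). unfold lower_terms, PS_derive.
       destruct n as [| [| [| m]]]; rewrite ?S_INR; simpl (INR 0); ring. }
  apply is_pseries_unique in Hsum. rewrite PSeries_const_0 in Hsum.
  rewrite Hsum. ring.
Qed.

(** At [r = 1] the slope is determined by the value, so only [y0] can be
    prescribed there. *)
Lemma analytic_solution (r y0 y1 : R) : 1 <= r ->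
  exists del (A : nat -> R -> R), 0 < del <= 1 / 2 /\
    (forall n x, Rabs (x - r) < del -> is_derive (A n) x (A (S n) x)) /\
    (forall x, Rabs (x - r) < del ->
       (1 - x ^ 2) * A 2%nat x + (2 / x - 4 * x) * A 1%nat x
         - 2 * A 0%nat x + A 0%nat x ^ 3 = 0) /\
    A 0%nat r = y0 /\ (1 < r -> A 1%nat r = y1).
Proof.
  intros Hr.
  assert (H : exists a M C, 0 <= M /\ 1 <= C /\ a 0%nat = y0 /\
    (1 < r -> a 1%nat = y1) /\
    coefficient_recurrence r a /\ forall n, Rabs (a n) <= M * C ^ n).
  { destruct (Req_dec r 1) as [-> | Hne].
    - destruct (coefficients_at_one y0) as [a [M [C [HM [HC [A0 H]]]]]].
      exists a, M, C. repeat (split; [assumption || lra|]). apply H.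
    - destruct (coefficients_at_regular_point r y0 y1)
        as [a [M [C [HM [HC [A0 [A1 H]]]]]]]; [lra|].
      exists a, M, C. repeat (split; [auto; apply H|]). apply H. }
  destruct H as [a [M [C [HM [HC [A0 [A1 [Hrec Ha]]]]]]]].
  assert (Hrad : forall n h, Rabs h < / (2 * C) ->
            Rbar_lt (Rabs h) (CV_radius (Nat.iter n PS_derive a))).
  { intros n h Hh. induction n as [| n IH]; simpl.
    - apply (radius_of_geometric_bound a M C); try lra. intros n.
      apply Rle_trans with (1 := Ha n).
      assert (0 <= M * C ^ n) by (apply Rmult_le_pos; [lra | apply pow_le; lra]).
      rewrite S_INR. assert (0 <= INR n) by apply pos_INR. nra.
    - now rewrite CV_radius_derive. }
  assert (HiC : 0 < / (2 * C)) by (apply Rinv_0_lt_compat; lra).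
  assert (/ (2 * C) <= 1 / 2).
  { unfold Rdiv. rewrite Rmult_1_l. apply Rinv_le_contravar; lra. }
  exists (/ (2 * C)), (fun n x => PSeries (Nat.iter n PS_derive a) (x - r)).
  split; [lra|]. split; [| split; [| split]].
  - intros n x Hx.
    evar_last.
    + apply (is_derive_comp (PSeries (Nat.iter n PS_derive a)) (fun y => y - r)).
      * apply is_derive_PSeries, Hrad, Hx.
      * auto_derive; [exact I | reflexivity].
    + apply Rmult_1_l.
  - intros x Hx.
    assert (Hode := power_series_solves r (x - r) M C a HM HC Hrec Ha Hx).
    replace (r + (x - r)) with x in Hode by ring.
    apply Rabs_def2 in Hx. assert (Hx0 : x <> 0) by lra.
    simpl Nat.iter. apply Rmult_eq_reg_l with x; [| exact Hx0].
    rewrite Rmult_0_r, <- Hode. field. exact Hx0.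
  - simpl. rewrite Rminus_diag, PSeries_0. exact A0.
  - intros Hr1. simpl. rewrite Rminus_diag, PSeries_0. unfold PS_derive.
    rewrite A1 by exact Hr1. simpl. ring.
Qed.

(** * Continuation and the maximal extension *)

(** The power series at [r] agrees with the given solution on some [[c, r]], by
    uniqueness to the left of [r]. All derivatives then agree on [[c, r]], so the
    glued family is locally one of the two given families. *)
Lemma extension_beyond (r : R) (D : nat -> R -> R) : 1 <= r ->
  solution_family (fun x => 0 <= x <= r) D ->
  exists r' F, r < r' /\ solution_family (fun x => 0 <= x < r') F /\
    forall x, 0 <= x <= r -> F 0%nat x = D 0%nat x.
Proof.
  intros Hr HD.
  destruct (analytic_solution r (D 0%nat r) (D 1%nat r) Hr)
    as [del [A [Hdel [HA [Aode [A0 A1]]]]]].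
  assert (Hc : exists c, 0 < c < r /\ r - del < c /\
            forall x, c <= x <= r -> D 0%nat x = A 0%nat x).
  { assert (Hsol : forall c, r - del < c < r -> 0 < c ->
      solves_on c r (A 0%nat) (A 1%nat) (A 2%nat) /\
      solution_family (fun x => c <= x <= r) D).
    { intros c Hc Hc0. split.
      - intros x Hx. assert (Rabs (x - r) < del) by (apply Rabs_def1; lra).
        split; [now apply HA|]. split; [now apply HA|]. intros _. now apply Aode.
      - revert HD. apply solution_family_sub. intros x Hx. lra. }
    destruct (Req_dec r 1) as [Hr1 | Hr1].
    - exists (r - del / 2). split; [lra|]. split; [lra|]. intros x Hx.
      destruct (Hsol (r - del / 2)) as [SA SD]; [lra | lra |].
      apply solution_family_solves in SD as [u [u1 [u2 [SD Eu]]]]; [| lra].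
      destruct (Eu x Hx) as [<- _].
      apply (unique_left_of_one (r - del / 2) r u u1 u2 _ (A 1%nat) (A 2%nat));
        auto; try lra.
      destruct (Eu r ltac:(lra)) as [Er _]. rewrite <- Hr1. congruence.
    - set (c := Rmax (r - del / 2) ((1 + r) / 2)).
      assert (c < r) by (apply Rmax_lub_lt; lra).
      assert (r - del / 2 <= c) by apply Rmax_l.
      assert ((1 + r) / 2 <= c) by apply Rmax_r.
      exists c. split; [lra|]. split; [lra|]. intros x Hx.
      destruct (Hsol c) as [SA SD]; [lra | lra |].
      apply solution_family_solves in SD as [u [u1 [u2 [SD Eu]]]]; [| lra].
      destruct (Eu x Hx) as [<- _]. destruct (Eu r ltac:(lra)) as [Er Er1].
      apply (unique_left_of_regular c r u u1 u2 _ (A 1%nat) (A 2%nat));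
        auto; rewrite ?A0, ?A1; auto; lra. }
  destruct Hc as [c [Hc0 [Hcr Hc]]].
  assert (Hall : forall n x, c <= x <= r -> D n x = A n x).
  { apply derivatives_agree; [lra | | | exact Hc].
    - refine (proj1 (solution_family_sub _ _ D _ HD)). intros x Hx. lra.
    - intros n x Hx. apply is_derive_D_in, HA. apply Rabs_def1; lra. }
  set (F := fun n x => if Rle_dec x r then D n x else A n x).
  assert (FD : forall n x, x <= r -> F n x = D n x).
  { intros n x Hx. unfold F. destruct (Rle_dec x r); [reflexivity | lra]. }
  assert (FA : forall n x, c <= x -> F n x = A n x).
  { intros n x Hx. unfold F. destruct (Rle_dec x r); [| reflexivity].
    apply Hall. lra. }
  exists (r + del), F. split; [lra|]. split; [split|].
  - intros n x Hx. destruct (Rlt_dec x r) as [Hxr | Hxr].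
    + apply (D_in_local (D n) _ (D (S n)) _ (fun y => 0 <= y <= r) _ _ (r - x)).
      * lra.
      * intros y Hy Hyx. apply Rabs_def2 in Hyx.
        split; [lra | apply FD; lra].
      * exact Hx.
      * apply FD. lra.
      * apply HD. lra.
    + apply (D_in_local (A n) _ (A (S n)) _ (fun _ => True) _ _ (x - c)).
      * lra.
      * intros y Hy Hyx. apply Rabs_def2 in Hyx.
        split; [exact I | apply FA; lra].
      * exact Hx.
      * apply FA. lra.
      * apply is_derive_D_in, HA. apply Rabs_def1; lra.
  - intros x Hx Hx0. destruct (Rle_dec x r) as [Hxr | Hxr].
    + rewrite !FD by lra. apply HD; lra.
    + rewrite !FA by lra. apply Aode. apply Rabs_def1; lra.
  - intros x Hx. apply FD. lra.
Qed.

Definition extends_family (U : R -> R) (s : R) (D : nat -> R -> R) : Prop :=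
  1 < s /\ solution_family (fun x => 0 <= x < s) D /\
  forall x, 0 <= x <= 1 -> D 0%nat x = U x.

Lemma extensions_agree (U : R -> R) (s t : R) (D F : nat -> R -> R) :
  extends_family U s D -> extends_family U t F ->
  forall n x, 0 <= x -> x < s -> x < t -> D n x = F n x.
Proof.
  intros [Hs [HD D0]] [Ht [HF F0]] n x Hx Hxs Hxt.
  set (m := Rmin s t).
  assert (1 < m) by now apply Rmin_glb_lt.
  assert (x < m) by now apply Rmin_glb_lt.
  assert (m <= s) by apply Rmin_l. assert (m <= t) by apply Rmin_r.
  set (y := Rmax ((1 + m) / 2) x).
  assert (y < m) by (apply Rmax_lub_lt; lra).
  assert ((1 + m) / 2 <= y) by apply Rmax_l.
  assert (x <= y) by apply Rmax_r.
  apply (solution_families_agree y); try lra.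
  - revert HD. apply solution_family_sub. intros z Hz. lra.
  - revert HF. apply solution_family_sub. intros z Hz. lra.
  - intros z Hz. now rewrite D0, F0.
Qed.

Lemma extension_bounded (U : R -> R) (s : R) (D : nat -> R -> R) :
  2 < U 1 ^ 2 -> extends_family U s D -> s <= exp (4 / (Rabs (U 1) - sqrt 2)).
Proof.
  intros HU [Hs [HD D0]]. apply Rnot_lt_le. intros Hlt.
  set (K := exp (4 / (Rabs (U 1) - sqrt 2))) in *.
  set (t := Rmax ((1 + s) / 2) K).
  assert (t < s) by (apply Rmax_lub_lt; lra).
  assert ((1 + s) / 2 <= t) by apply Rmax_l. assert (K <= t) by apply Rmax_r.
  destruct (solution_family_solves 1 t D) as [u [u1 [u2 [Hu Eu]]]]; [lra | |].
  { revert HD. apply solution_family_sub. intros x Hx. lra. }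
  destruct (Eu 1 ltac:(lra)) as [E1 _]. rewrite D0 in E1 by lra.
  assert (t < K); [| lra].
  unfold K. rewrite <- E1. apply (finite_lifespan u u1 u2); [lra | exact Hu|].
  now rewrite E1.
Qed.

Theorem mainTheorem3 (U : R -> R)
  (smooth_U : smooth_solution (fun rho => 0 <= rho <= 1) U)
  (nonconstant_U : exists rho sigma : R,
     0 <= rho <= 1 /\ 0 <= sigma <= 1 /\ U rho <> U sigma) :
  (exists (rho_star : R) (V : R -> R),
     1 < rho_star /\ maximal_smooth_extension U rho_star V) /\
  ~ (exists W : R -> R,
       extends_from_unit U W /\ smooth_solution (fun rho => 0 <= rho) W).
Proof.
  apply smooth_solution_family in smooth_U as [D0 [HD0 ED0]].
  assert (HU : 2 < U 1 ^ 2).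
  { destruct (solution_family_solves 0 1 D0 Rlt_0_1 HD0)
      as [u [u1 [u2 [Hu Eu]]]].
    assert (E : forall x, 0 <= x <= 1 -> u x = U x).
    { intros x Hx. rewrite <- ED0 by exact Hx. now apply Eu. }
    rewrite <- E by lra. apply (large_value_at_one u u1 u2 Hu).
    destruct nonconstant_U as [x [y [Hx [Hy Hxy]]]].
    exists x, y. now rewrite !E. }
  split.
  2: { intros [W [HW SW]]. apply smooth_solution_family in SW as [F [HF EF]].
    set (K := exp (4 / (Rabs (U 1) - sqrt 2))).
    assert (0 < K) by apply exp_pos.
    assert (K + 2 <= K); [| lra].
    apply (extension_bounded U (K + 2) F HU). split; [lra|]. split.
    - revert HF. apply solution_family_sub. intros x Hx. lra.
    - intros x Hx. rewrite EF by lra. now apply HW. }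
  destruct (completeness (fun s => exists D, extends_family U s D))
    as [rs [Hub Hlub]].
  { exists (exp (4 / (Rabs (U 1) - sqrt 2))). intros s [D HD].
    now apply (extension_bounded U s D). }
  { destruct (extension_beyond 1 D0 (Rle_refl 1) HD0) as [s [F [Hs [HF EF]]]].
    exists s, F. split; [exact Hs|]. split; [exact HF|].
    intros x Hx. rewrite EF by exact Hx. now apply ED0. }
  assert (Hbelow : forall x, x < rs -> exists p : R * (nat -> R -> R),
            x < fst p /\ extends_family U (fst p) (snd p)).
  { intros x Hx. apply NNPP. intros Hn.
    assert (rs <= x); [| lra]. apply Hlub. intros s [D HD].
    apply Rnot_lt_le. intros Hlt. apply Hn. now exists (s, D). }
  assert (Hrs : 1 < rs).
  { destruct (extension_beyond 1 D0 (Rle_refl 1) HD0) as [s [F [Hs [HF EF]]]].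
    apply Rlt_le_trans with s; [exact Hs|]. apply Hub. exists F.
    split; [exact Hs|]. split; [exact HF|].
    intros x Hx. rewrite EF by exact Hx. now apply ED0. }
  assert (Hchoice : forall x, exists p : R * (nat -> R -> R),
            x < rs -> x < fst p /\ extends_family U (fst p) (snd p)).
  { intros x. destruct (Rlt_dec x rs) as [Hx | Hx].
    - destruct (Hbelow x Hx) as [p Hp]. now exists p.
    - exists (0, fun _ _ => 0). intros H. lra. }
  set (pick := fun x => proj1_sig (constructive_indefinite_description _ (Hchoice x))).
  assert (Hpick : forall x, x < rs ->
            x < fst (pick x) /\ extends_family U (fst (pick x)) (snd (pick x))).
  { intros x. unfold pick.
    exact (proj2_sig (constructive_indefinite_description _ (Hchoice x))). }
  (* near x the family V is the extension chosen at x, by uniqueness *)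
  set (V := fun n x => snd (pick x) n x).
  assert (HV : forall s D, extends_family U s D ->
            forall n x, 0 <= x < s -> V n x = D n x).
  { intros s D HD n x Hx.
    assert (s <= rs) by (apply Hub; now exists D).
    destruct (Hpick x ltac:(lra)) as [Hx' Hp].
    apply (extensions_agree U _ _ _ _ Hp HD); lra. }
  exists rs, (V 0%nat). split; [exact Hrs|]. split; [| split].
  - intros x Hx. destruct (Hpick 1 Hrs) as [H1 Hp].
    rewrite (HV _ _ Hp) by lra. now apply Hp.
  - apply smooth_solution_family. exists V. split; [split | reflexivity].
    + intros n x Hx. destruct (Hpick x ltac:(lra)) as [Hx' Hp].
      apply (D_in_local (snd (pick x) n) _ (snd (pick x) (S n)) _
        (fun y => 0 <= y < fst (pick x)) _ _ (fst (pick x) - x)).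
      * lra.
      * intros y Hy Hyx. apply Rabs_def2 in Hyx. split; [lra|].
        apply (HV _ _ Hp). lra.
      * exact Hx.
      * apply (HV _ _ Hp). lra.
      * apply Hp. lra.
    + intros x Hx Hx0. destruct (Hpick x ltac:(lra)) as [Hx' Hp].
      rewrite !(HV _ _ Hp) by lra. apply Hp; lra.
  - intros J W HJ HW SW x Jx. apply smooth_solution_family in SW as [F [HF EF]].
    destruct HJ as [J0 [J1 J2]].
    set (y := Rmax 1 x).
    assert (1 <= y) by apply Rmax_l. assert (x <= y) by apply Rmax_r.
    assert (Jy : J y) by (unfold y, Rmax; destruct (Rle_dec 1 x);
                          [exact Jx | apply J1; lra]).
    assert (HJy : forall z, 0 <= z <= y -> J z) by (intros z; now apply J2).
    (* W lives at least up to y and continues beyond it, so y < rs *)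
    destruct (extension_beyond y F) as [s [F' [Hs [HF' EF']]]]; [lra | |].
    { revert HF. now apply solution_family_sub. }
    assert (He : extends_family U s F').
    { split; [lra|]. split; [exact HF'|]. intros z Hz.
      rewrite EF', EF by (try apply HJy; lra). now apply HW. }
    assert (s <= rs) by (apply Hub; now exists F').
    specialize (J0 x Jx). split; [lra|].
    rewrite (HV _ _ He) by lra. rewrite EF' by lra. symmetry. now apply EF.
Qed.
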